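(* Let $\Lambda=kQ/I$ be a bound quiver algebra over a field $k$. If the excess $e(\Lambda)$ is zero, then there is a canonical isomorphism of $k$-vector spaces $$\mathrm{HH}^2(\Lambda)\cong \mathrm{Hom}_{kQ-kQ}(I/I^2,\Lambda).$$
   Context: $k$ is a field. ''Algebra'' means finite dimensional associative unital $k$-algebra; modules over it are finitely generated. For an algebra $\Lambda$, $\Lambda^e=\Lambda\otimes_k\Lambda^{op}$, and $\Lambda$-bimodules are identified with left $\Lambda^e$-modules; $\mathrm{Hom}_{\Lambda-\Lambda}$, $\mathrm{Ext}_{\Lambda-\Lambda}$ denote Hom and Ext over $\Lambda^e$. $\mathrm{HH}^n(\Lambda)=\mathrm{Ext}^n_{\Lambda-\Lambda}(\Lambda,\Lambda)$ is Hochschild cohomology. Auslander-Reiten translation: $\mathsf D=\mathrm{Hom}_k(-,k)$. For an algebra $A$ and a left $A$-module $M$ with minimal projective presentation $P_1\xrightarrow{d_1}P_0\to M\to 0$, $\mathrm{Tr}\,M$ is the cokernel of $d_1^*:\mathrm{Hom}_A(P_0,A)\to\mathrm{Hom}_A(P_1,A)$ and $\tau M=\mathsf D\,\mathrm{Tr}\,M$. Here $\tau\Lambda$ is computed with $A=\Lambda^e$ and $M=\Lambda$. The first $\tau$-Hochschild cohomology is $\mathrm{HH}^1_\tau(\Lambda)=\mathsf D\,\mathrm{Hom}_{\Lambda-\Lambda}(\Lambda,\tau\Lambda)$. The excess is $e(\Lambda)=\dim_k\mathrm{HH}^1_\tau(\Lambda)-\dim_k\mathrm{HH}^1(\Lambda)$.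 A quiver $Q$ is a finite oriented graph with vertices $Q_0$, arrows $Q_1$, source and target maps $s,t:Q_1\to Q_0$. $kQ$ is the path algebra with basis all oriented paths (including the vertices, the paths of length $0$). $F=\langle Q_1\rangle$ is the ideal generated by the arrows. A two-sided ideal $I$ of $kQ$ is admissible if $F^n\subset I\subset F^2$ for some $n\ge 2$; then $kQ/I$ is called a bound quiver algebra. $\mathrm{Hom}_{kQ-kQ}$ denotes morphisms of $kQ$-bimodules; $I/I^2$ and $\Lambda=kQ/I$ are $kQ$-bimodules in the natural way. *)

(* Defs.v *)
From HB Require Import structures.
From mathcomp Require Import all_boot all_algebra all_field.
From mathcomp Require Import finmap boolp.
From mathcomp Require Import monalg.

Set Implicit Arguments.
Unset Strict Implicit.
Unset Printing Implicit Defensive.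

Import GRing.Theory.
Local Open Scope ring_scope.
Local Open Scope quotient_scope.

(* P is the membership predicate of a linear subspace of V *)
Definition submod_prop (k : fieldType) (V : lmodType k) (P : V -> Prop) : Prop :=
  P 0 /\ forall (a : k) u v, P u -> P v -> P (a *: u + v).

Section Comprehension.
Variables (k : fieldType) (V : vectType k).

Lemma vspace_of_subproof (P : V -> Prop) :
  submod_prop P -> exists U : {vspace V}, forall v, v \in U <-> P v.
Proof.
move=> [P0 Pl].
pose good n := `[< exists U : {vspace V}, \dim U = n /\ forall v, v \in U -> P v >].
have ex0 : exists n, good n.
  exists 0; apply/asboolP; exists 0%VS; rewrite dimv0; split=> // v.
  by rewrite memv0 => /eqP->.
have bd n : good n -> (n <= \dim {:V})%N.
  by move=> /asboolP[U [<- _]]; apply/dimvS/subvf.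
case: (ex_maxnP ex0 bd) => n /asboolP[U [dU UP]] nmax.
exists U => v; split; first exact: UP.
move=> Pv; have : good (\dim (U + <[v]>)%VS).
  apply/asboolP; exists (U + <[v]>)%VS; split=> // w.
  by move=> /memv_addP[u /UP Pu [_ /vlineP[c ->] ->]]; rewrite addrC; apply: Pl.
move=> /nmax; rewrite -dU => le.
have /eqP-> : U == (U + <[v]>)%VS by rewrite eqEdim addvSl.
by rewrite memvE addvSr.
Qed.

Definition vspace_of (P : V -> Prop) (hP : submod_prop P) : {vspace V} :=
  sval (cid (vspace_of_subproof hP)).

Lemma mem_vspace_of P (hP : submod_prop P) v : v \in vspace_of hP <-> P v.
Proof. exact: (svalP (cid (vspace_of_subproof hP)) v). Qed.

End Comprehension.

Lemma fg_vect_iso (k : fieldType) (V : lmodType k) n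
    (g : 'rV[k]_n -> V) : linear g ->
  (forall v, exists x, g x = v) ->
  exists m : nat, exists2 h : V -> 'rV[k]_m, linear h & bijective h.
Proof.
move=> glin gs.
pose gm := GRing.isLinear.Build _ _ _ _ g glin.
pose gl : {linear 'rV[k]_n -> V} := HB.pack g gm.
have gD x y : g (x + y) = g x + g y by exact: (linearD gl).
have gB x y : g (x - y) = g x - g y by exact: (linearB gl).
have g0 : g 0 = 0 by exact: (linear0 gl).
have hK : submod_prop (fun x => g x = 0).
  by split=> [|a u v u0 v0]; rewrite ?g0 // glin u0 v0 scaler0 addr0.
pose K := vspace_of hK; pose C := (K^C)%VS.
have KP x : x \in K <-> g x = 0 by exact: mem_vspace_of.
pose s v := sval (cid (gs v)); have gs' v : g (s v) = v := svalP (cid (gs v)).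
have KC : (K :&: C = 0)%VS by rewrite capv_compl.
have CK : (C :&: K = 0)%VS by rewrite capvC.
have dec w : daddv_pi C K w + daddv_pi K C w = w.
  by apply: daddv_pi_add => //; rewrite addvC addv_complf memvf.
have piK x : x \in K -> daddv_pi C K x = 0.
  by move=> xK; have := dec x; rewrite (daddv_pi_id KC xK) -{3}[x]add0r => /addIr.
have pig x : g (daddv_pi C K x) = g x.
  by rewrite -{2}(dec x) gD (proj1 (KP (daddv_pi K C x))) ?addr0 ?memv_pi.
pose h v := vsproj C (daddv_pi C K (s v)).
have hlin : linear h.
  move=> a u v; rewrite /h -linearP -linearP; congr (vsproj C _); apply/eqP.
  by rewrite -subr_eq0 -linearB; apply/eqP/piK/KP; rewrite gB glin !gs' subrr.
have vh v : vsval (h v) = daddv_pi C K (s v) by rewrite vsprojK ?memv_pi.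
have hK' : cancel h (fun y => g (vsval y)) by move=> v; rewrite vh pig gs'.
have hK2 : cancel (fun y : subvs_of C => g (vsval y)) h.
  move=> y; apply: val_inj; rewrite /= vh; apply/eqP; rewrite -subr_eq0.
  rewrite -{2}(daddv_pi_id CK (subvsP y)) -linearB.
  by apply/eqP/piK/KP; rewrite gB gs' subrr.
have [r rlin rbij] := @subvs_vect_iso _ _ C.
exists (\dim C), (r \o h); first by move=> a u v; rewrite /= hlin rlin.
by apply: bij_comp rbij _; exists (fun y => g (vsval y)).
Qed.

(* The quotient of V by the submodule {x | P x} *)
Section LinearQuotient.
Variables (k : fieldType) (V : lmodType k).
Variables (P : V -> Prop) (hP : submod_prop P).

Definition submod_pred of submod_prop P : pred V := fun x => `[< P x >].

Fact submod_pred_zmod_closed : zmod_closed (submod_pred hP).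
Proof.
split=> [|x y /asboolP Px /asboolP Py]; apply/asboolP; first exact: hP.1.
by rewrite addrC -scaleN1r; apply: hP.2.
Qed.
HB.instance Definition _ := GRing.isZmodClosed.Build V (submod_pred hP)
  submod_pred_zmod_closed.
Definition submod_zmodClosed : zmodClosed V :=
  GRing.ZmodClosed.clone V (submod_pred hP) _.

Definition lquot : Type := Quotient.quot submod_zmodClosed.
HB.instance Definition _ := GRing.Zmodule.on lquot.

Definition lquot_pi (x : V) : lquot := \pi_(Quotient.quot submod_zmodClosed) x.

Lemma lquot_pi_eq x y : lquot_pi x = lquot_pi y <-> P (x - y).
Proof.
have := Quotient.idealrBE submod_zmodClosed x y; rewrite /lquot_pi => E.
split=> [/eqP|Pxy]; first by rewrite -E => /asboolP.
by apply/eqP; rewrite -E; apply/asboolP.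
Qed.

Lemma lquot_piD x y : lquot_pi (x + y) = lquot_pi x + lquot_pi y.
Proof. exact: (raddfD (\pi_(Quotient.quot submod_zmodClosed))). Qed.

Definition lquot_repr (x : lquot) : V := repr (x : Quotient.quot submod_zmodClosed).
Lemma lquot_reprK x : lquot_pi (lquot_repr x) = x.
Proof. exact: reprK. Qed.

Definition lquot_scale (a : k) (x : lquot) : lquot :=
  lquot_pi (a *: lquot_repr x).

Lemma lquot_scale_pi a x : lquot_scale a (lquot_pi x) = lquot_pi (a *: x).
Proof.
apply/lquot_pi_eq; rewrite -scalerBr -[_ *: _]addr0.
by apply: hP.2 hP.1; apply/lquot_pi_eq; rewrite lquot_reprK.
Qed.

Fact lquot_scaleA a b v : lquot_scale a (lquot_scale b v) = lquot_scale (a * b) v.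
Proof. by rewrite -[v]lquot_reprK !lquot_scale_pi scalerA. Qed.
Fact lquot_scale1 : left_id 1 lquot_scale.
Proof. by move=> v; rewrite -[v]lquot_reprK lquot_scale_pi scale1r. Qed.
Fact lquot_scaleDr : right_distributive lquot_scale +%R.
Proof.
move=> a u v; rewrite -[v]lquot_reprK -[u]lquot_reprK.
by rewrite -lquot_piD !lquot_scale_pi scalerDr lquot_piD.
Qed.
Fact lquot_scaleDl v : {morph lquot_scale^~ v : a b / a + b}.
Proof.
move=> a b; rewrite -[v]lquot_reprK.
by rewrite !lquot_scale_pi scalerDl lquot_piD.
Qed.
HB.instance Definition _ := GRing.Zmodule_isLmodule.Build k lquot
  lquot_scaleA lquot_scale1 lquot_scaleDr lquot_scaleDl.

Fact lquot_pi_linear : linear lquot_pi.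
Proof. by move=> a u v; rewrite lquot_piD -lquot_scale_pi. Qed.
HB.instance Definition _ := GRing.isLinear.Build k V lquot _ lquot_pi
  lquot_pi_linear.

Lemma lquot_pi0 x : lquot_pi x = 0 <-> P x.
Proof. by rewrite -(linear0 lquot_pi) lquot_pi_eq subr0. Qed.
End LinearQuotient.

Section VectorQuotient.
Variables (k : fieldType) (V : vectType k) (U : {vspace V}).

Fact vspace_submod_prop : submod_prop (fun x : V => x \in U).
Proof. by split=> [|a u v Uu Uv]; rewrite ?mem0v ?memvD ?memvZ. Qed.

Definition vquot : Type := lquot vspace_submod_prop.
HB.instance Definition _ := GRing.Lmodule.on vquot.
Definition vquot_pi : V -> vquot := @lquot_pi k V _ vspace_submod_prop.
HB.instance Definition _ := GRing.Linear.on vquot_pi.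

Import VectorInternalTheory.
Fact vquot_vect_iso :
  exists m : nat, exists2 h : vquot -> 'rV[k]_m, linear h & bijective h.
Proof.
apply: (@fg_vect_iso k vquot (dim V) (vquot_pi \o r2v)) => [a u v|v].
  by rewrite /= !linearP.
by exists (v2r (lquot_repr v)); rewrite /= v2rK; exact: lquot_reprK.
Qed.
HB.instance Definition _ := Lmodule_hasFinDim.Build k vquot
  (let: exist2 h a b := cid2 (svalP (cid vquot_vect_iso)) in exist2 _ _ h a b).

Lemma vquot_pi_eq x y : vquot_pi x = vquot_pi y <-> x - y \in U.
Proof. exact: lquot_pi_eq. Qed.
Definition vquot_repr : vquot -> V := @lquot_repr k V _ vspace_submod_prop.
Lemma vquot_reprK x : vquot_pi (vquot_repr x) = x.
Proof. exact: lquot_reprK. Qed.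
End VectorQuotient.

Section Ideals.
Variables (k : fieldType) (B : algType k).

Definition two_sided_ideal (I : B -> Prop) : Prop :=
  [/\ I 0, forall x y, I x -> I y -> I (x + y) &
      forall a x, I x -> I (a * x) /\ I (x * a)].

(* the smallest two-sided ideal containing X *)
Definition ideal_gen (X : B -> Prop) : B -> Prop :=
  fun x => forall J, two_sided_ideal J -> (forall y, X y -> J y) -> J x.

Definition ideal_mul (I J : B -> Prop) : B -> Prop :=
  fun x => exists2 s : seq (B * B),
    (forall p, p \in s -> I p.1 /\ J p.2) & x = \sum_(p <- s) p.1 * p.2.

Fixpoint ideal_pow (I : B -> Prop) (n : nat) : B -> Prop :=
  if n is m.+1 then ideal_mul I (ideal_pow I m) else fun=> True.

Lemma ideal_submod_prop (I : B -> Prop) : two_sided_ideal I -> submod_prop I.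
Proof.
move=> [I0 ID IM]; split=> // a u v Iu Iv; apply: ID => //.
by rewrite -mulr_algl; apply: (IM _ _ Iu).1.
Qed.

Lemma ideal_gen_ideal X : two_sided_ideal (ideal_gen X).
Proof.
split=> [J [] //|x y gx gy J hJ XJ|a x gx].
  by case: (hJ) => _ JD _; apply: JD; [apply: gx | apply: gy].
by split=> J hJ XJ; case: (hJ) => _ _ /(_ a x (gx J hJ XJ)) [].
Qed.

Lemma ideal_gen_sub X x : X x -> ideal_gen X x.
Proof. by move=> Xx J _; apply. Qed.

Lemma ideal_mul_in (I J : B -> Prop) a b : I a -> J b -> ideal_mul I J (a * b).
Proof.
by exists [:: (a, b)]; rewrite ?big_seq1 // => p /[!inE] /eqP->.
Qed.

Lemma ideal_mulD (I J : B -> Prop) x y :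
  ideal_mul I J x -> ideal_mul I J y -> ideal_mul I J (x + y).
Proof.
move=> [s hs ->] [t ht ->]; exists (s ++ t); last by rewrite big_cat.
by move=> p; rewrite mem_cat => /orP[/hs|/ht].
Qed.

Lemma ideal_mul0 (I J : B -> Prop) : ideal_mul I J 0.
Proof. by exists [::]; rewrite ?big_nil. Qed.

Lemma ideal_mul_sum (I J : B -> Prop) (T : eqType) (s : seq T) (F : T -> B) :
  (forall p, p \in s -> ideal_mul I J (F p)) ->
  ideal_mul I J (\sum_(p <- s) F p).
Proof.
elim: s => [|p s IHs] h; first by rewrite big_nil; apply: ideal_mul0.
rewrite big_cons; apply: ideal_mulD; first by apply: h; rewrite mem_head.
by apply: IHs => q qs; apply: h; rewrite inE qs orbT.
Qed.

Lemma ideal_mul_ideal (I J : B -> Prop) :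
  two_sided_ideal I -> two_sided_ideal J -> two_sided_ideal (ideal_mul I J).
Proof.
move=> [_ _ IM] [_ _ JM]; split; [exact: ideal_mul0|exact: ideal_mulD|].
move=> a x [s hs ->]; split.
  rewrite mulr_sumr; apply: ideal_mul_sum => p /hs[Ip Jp].
  by rewrite mulrA; apply: ideal_mul_in Jp; apply: (IM _ _ Ip).1.
rewrite mulr_suml; apply: ideal_mul_sum => p /hs[Ip Jp].
by rewrite -mulrA; apply: ideal_mul_in Ip _; apply: (JM _ _ Jp).2.
Qed.

Lemma ideal_powD (I : B -> Prop) m n x :
  ideal_pow I (m + n) x -> ideal_mul (ideal_pow I m) (ideal_pow I n) x.
Proof.
elim: m x => [|m IHm] x /=.
  by rewrite add0n -{2}[x]mul1r => h; apply: ideal_mul_in.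
move=> [s hs ->]; apply: ideal_mul_sum => -[a y] /hs /= [Ia /IHm[t ht ->]].
rewrite mulr_sumr; apply: ideal_mul_sum => -[u v] /ht /= [Iu Iv].
by rewrite mulrA; apply: ideal_mul_in Iv; apply: ideal_mul_in.
Qed.

Record proper_ideal := ProperIdeal {
  ideal_set :> B -> Prop;
  idealP : two_sided_ideal ideal_set;
  ideal_proper : ~ ideal_set 1 }.

End Ideals.

(* The quotient of B by a proper two-sided ideal *)
Section AlgebraQuotient.
Variables (k : fieldType) (B : algType k) (I : proper_ideal B).

Definition aquot : Type := lquot (ideal_submod_prop (idealP I)).
HB.instance Definition _ := GRing.Lmodule.on aquot.
Definition aquot_pi : B -> aquot := @lquot_pi k B _ (ideal_submod_prop (idealP I)).
HB.instance Definition _ := GRing.Linear.on aquot_pi.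
Definition aquot_repr : aquot -> B := @lquot_repr k B _ (ideal_submod_prop (idealP I)).
Lemma aquot_reprK x : aquot_pi (aquot_repr x) = x.
Proof. exact: lquot_reprK. Qed.
Lemma aquot_pi_eq x y : aquot_pi x = aquot_pi y <-> I (x - y).
Proof. exact: lquot_pi_eq. Qed.
Lemma aquot_pi0 x : aquot_pi x = 0 <-> I x.
Proof. exact: lquot_pi0. Qed.

Definition aquot_mul (x y : aquot) : aquot :=
  aquot_pi (aquot_repr x * aquot_repr y).

Lemma aquot_mul_pi x y : aquot_mul (aquot_pi x) (aquot_pi y) = aquot_pi (x * y).
Proof.
case: (idealP I) => _ ID IM; apply/aquot_pi_eq.
set x' := aquot_repr _; set y' := aquot_repr _.
have hx : I (x' - x) by apply/aquot_pi_eq; rewrite aquot_reprK.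
have hy : I (y' - y) by apply/aquot_pi_eq; rewrite aquot_reprK.
have -> : x' * y' - x * y = (x' - x) * y' + x * (y' - y).
  by rewrite mulrBl mulrBr addrA subrK.
by apply: ID; [apply: (IM _ _ hx).2 | apply: (IM _ _ hy).1].
Qed.

Fact aquot_mulA : associative aquot_mul.
Proof.
move=> x y z; rewrite -[x]aquot_reprK -[y]aquot_reprK -[z]aquot_reprK.
by rewrite !aquot_mul_pi mulrA.
Qed.
Fact aquot_mul1x : left_id (aquot_pi 1) aquot_mul.
Proof. by move=> x; rewrite -[x]aquot_reprK aquot_mul_pi mul1r. Qed.
Fact aquot_mulx1 : right_id (aquot_pi 1) aquot_mul.
Proof. by move=> x; rewrite -[x]aquot_reprK aquot_mul_pi mulr1. Qed.
Fact aquot_mulDl : left_distributive aquot_mul +%R.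
Proof.
move=> x y z; rewrite -[x]aquot_reprK -[y]aquot_reprK -[z]aquot_reprK.
by rewrite -linearD !aquot_mul_pi mulrDl linearD.
Qed.
Fact aquot_mulDr : right_distributive aquot_mul +%R.
Proof.
move=> x y z; rewrite -[x]aquot_reprK -[y]aquot_reprK -[z]aquot_reprK.
by rewrite -linearD !aquot_mul_pi mulrDr linearD.
Qed.
Fact aquot_oner_neq0 : aquot_pi 1 != 0.
Proof. by apply/eqP => /aquot_pi0; apply: ideal_proper. Qed.
HB.instance Definition _ := GRing.Zmodule_isNzRing.Build aquot
  aquot_mulA aquot_mul1x aquot_mulx1 aquot_mulDl aquot_mulDr aquot_oner_neq0.

Fact aquot_piM x y : aquot_pi (x * y) = aquot_pi x * aquot_pi y.
Proof. exact/esym/aquot_mul_pi. Qed.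

Fact aquot_scaleAl (a : k) (x y : aquot) : a *: (x * y) = (a *: x) * y.
Proof.
rewrite -[x]aquot_reprK -[y]aquot_reprK.
by rewrite -aquot_piM -!linearZ -aquot_piM scalerAl.
Qed.
HB.instance Definition _ := GRing.Lmodule_isLalgebra.Build k aquot aquot_scaleAl.
Fact aquot_scaleAr (a : k) (x y : aquot) : a *: (x * y) = x * (a *: y).
Proof.
rewrite -[x]aquot_reprK -[y]aquot_reprK.
by rewrite -aquot_piM -!linearZ -aquot_piM scalerAr.
Qed.
HB.instance Definition _ := GRing.Lalgebra_isAlgebra.Build k aquot aquot_scaleAr.

HB.instance Definition _ := GRing.isMonoidMorphism.Build B aquot aquot_pi
  (erefl, aquot_piM).
End AlgebraQuotient.

(* The vertex set is nonempty because rings in this library are nonzero. *)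
Record quiver := Quiver {
  vertex : finType;
  arrow : finType;
  source : arrow -> vertex;
  target : arrow -> vertex;
  vertex_gt0 : (0 < #|vertex|)%N }.

Section Paths.
Variable Q : quiver.

Fixpoint walk (v : vertex Q) (s : seq (arrow Q)) : bool :=
  if s is a :: s' then (source a == v) && walk (target a) s' else true.

Definition walk_end (v : vertex Q) (s : seq (arrow Q)) : vertex Q :=
  last v (map (@target Q) s).

(* A path is a starting vertex with a list of successive arrows; (v, [::]) is
   the trivial path at v. *)
Record qpath := QPath { qpath_val : vertex Q * seq (arrow Q);
                        _ : walk qpath_val.1 qpath_val.2 }.
HB.instance Definition _ := [isSub for qpath_val].
HB.instance Definition _ := [Choice of qpath by <:].

Definition psource (p : qpath) : vertex Q := (qpath_val p).1.
Definition parrows (p : qpath) : seq (arrow Q) := (qpath_val p).2.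
Definition ptarget (p : qpath) : vertex Q := walk_end (psource p) (parrows p).

Definition vpath (v : vertex Q) : qpath := @QPath (v, [::]) isT.

Fact apath_subproof a : walk (source a) [:: a].
Proof. by rewrite /= eqxx. Qed.
Definition apath (a : arrow Q) : qpath := @QPath (_, _) (apath_subproof a).

(* Paths compose from left to right: [pcat p q] runs through p, then q. *)
Definition pcat (p q : qpath) : option qpath :=
  if ptarget p == psource q then insub (psource p, parrows p ++ parrows q)
  else None.

Lemma walk_cat v s t : walk v (s ++ t) = walk v s && walk (walk_end v s) t.
Proof. by elim: s v => //= a s IHs v; rewrite IHs andbA. Qed.

Lemma walk_end_cat v s t : walk_end v (s ++ t) = walk_end (walk_end v s) t.
Proof. by rewrite /walk_end map_cat last_cat. Qed.

Lemma walkP (p : qpath) : walk (psource p) (parrows p).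
Proof. by case: p. Qed.

Lemma qpath_inj (p q : qpath) :
  psource p = psource q -> parrows p = parrows q -> p = q.
Proof.
move=> es ea; apply: val_inj; move: es ea; rewrite /psource /parrows /=.
by case: (qpath_val p) (qpath_val q) => [? ?] [? ?] /= -> ->.
Qed.

Variant pcat_spec (p q : qpath) : option qpath -> Prop :=
| PcatSome r of ptarget p = psource q & psource r = psource p
    & parrows r = parrows p ++ parrows q & ptarget r = ptarget q
  : pcat_spec p q (Some r)
| PcatNone of ptarget p <> psource q : pcat_spec p q None.

Lemma pcatP p q : pcat_spec p q (pcat p q).
Proof.
rewrite /pcat; case: eqP => [e|ne]; last by constructor.
case: insubP => [r _ er|].
  have es : psource r = psource p by rewrite /psource er.
  have ea : parrows r = parrows p ++ parrows q by rewrite /parrows er.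
  by constructor; rewrite // /ptarget es ea walk_end_cat -/(ptarget p) e.
by rewrite /= walk_cat walkP -/(ptarget p) e walkP.
Qed.

Lemma pcatA p q r :
  obind (fun x => pcat x r) (pcat p q) = obind (pcat p) (pcat q r).
Proof.
case: (pcatP p q) => [x e1 s1 a1 t1|n1]; case: (pcatP q r) => [y e2 s2 a2 t2|n2] //=.
- case: (pcatP x r) => [z f1 u1 b1 v1|]; last by rewrite t1 e2.
  case: (pcatP p y) => [w f2 u2 b2 v2|]; last by rewrite s2 e1.
  congr Some; apply: qpath_inj; first by rewrite u1 u2 s1.
  by rewrite b1 b2 a1 a2 catA.
- by case: (pcatP x r) => // z; rewrite t1.
- by case: (pcatP p y) => // z; rewrite s2.
Qed.

Lemma pcat_vl v p : pcat (vpath v) p = if v == psource p then Some p else None.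
Proof.
case: pcatP => [r /= e s a _|n]; last by rewrite ifN //; apply/eqP.
by rewrite -e /= eqxx; congr Some; apply: qpath_inj; rewrite ?s ?a // -e.
Qed.

Lemma pcat_vr v p : pcat p (vpath v) = if v == ptarget p then Some p else None.
Proof.
case: pcatP => [r /= e s a _|n]; last by rewrite ifN // eq_sym; apply/eqP.
by rewrite e eqxx; congr Some; apply: qpath_inj; rewrite ?s ?a ?cats0.
Qed.

End Paths.

Section LinearFacts.
Variables (k : fieldType) (V W : lmodType k) (f : V -> W).
Hypothesis fl : linear f.
Lemma lin0 : f 0 = 0.
Proof. by apply: (addrI (f 0)); rewrite -{1}[f 0]scale1r -fl scaler0 !addr0. Qed.
Lemma linD x y : f (x + y) = f x + f y.
Proof. by rewrite -{1}[x]scale1r fl scale1r. Qed.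
Lemma linB x y : f (x - y) = f x - f y.
Proof. by rewrite addrC -scaleN1r fl scaleN1r addrC. Qed.
Lemma linZ a x : f (a *: x) = a *: f x.
Proof. by rewrite -[a *: x]addr0 fl lin0 addr0. Qed.
Lemma lin_sum (T : Type) (r : seq T) (P : pred T) (F : T -> V) :
  f (\sum_(i <- r | P i) F i) = \sum_(i <- r | P i) f (F i).
Proof. exact: (big_morph f linD lin0). Qed.
End LinearFacts.

Section LinearExtension.
Variables (k : fieldType) (K : choiceType) (V : lmodType k).

Lemma malg_basisE (x : {malg k[K]}) : x = \sum_(p <- msupp x) x@_p *: << p >>.
Proof.
rewrite {1}[x]monalgE; apply: eq_bigr => p _; apply/malgP => q.
by rewrite mcoeffZ !mcoeffU mulr_natr.
Qed.

Lemma sum_msupp (h : K -> V) (x : {malg k[K]}) (D : {fset K}) :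
  (msupp x `<=` D)%fset ->
  \sum_(p <- msupp x) x@_p *: h p = \sum_(p <- D) x@_p *: h p.
Proof.
move=> /fsubsetP xD; rewrite [RHS](bigID (fun p => p \in msupp x)) /=.
rewrite [X in _ + X]big1 ?addr0; last first.
  by move=> p /mcoeff_outdom->; rewrite scale0r.
rewrite -[RHS]big_filter; apply: perm_big; apply: uniq_perm.
- exact: fset_uniq.
- by rewrite filter_uniq // fset_uniq.
by move=> p; rewrite mem_filter; case: (boolP (p \in msupp x)) => // /xD->.
Qed.

Lemma linext_linear (h : K -> V) :
  linear (fun x : {malg k[K]} => \sum_(p <- msupp x) x@_p *: h p).
Proof.
move=> a x y; pose D := (msupp x `|` msupp y `|` msupp (a *: x + y))%fset.
have h1 : (msupp x `<=` D)%fset by rewrite /D -fsetUA fsubsetUl.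
have h2 : (msupp y `<=` D)%fset by rewrite /D fsetUAC fsubsetUr.
have h3 : (msupp (a *: x + y) `<=` D)%fset by rewrite /D fsubsetUr.
rewrite (sum_msupp h h1) (sum_msupp h h2) (sum_msupp h h3).
rewrite scaler_sumr -big_split; apply: eq_bigr => p _ /=.
by rewrite mcoeffD mcoeffZ scalerDl scalerA.
Qed.
End LinearExtension.

Definition path_alg (k : fieldType) (Q : quiver) : Type := {malg k[qpath Q]}.
HB.instance Definition _ k Q := GRing.Lmodule.on (path_alg k Q).

HB.lock Definition pbasis (k : fieldType) (Q : quiver) (p : qpath Q)
    : path_alg k Q := << p >>.
Arguments pbasis k {Q} p.

Definition pmul (k : fieldType) (Q : quiver) (p q : qpath Q) : path_alg k Q :=
  oapp (pbasis k) 0 (pcat p q).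

HB.lock Definition path_mul (k : fieldType) (Q : quiver) (x y : path_alg k Q)
    : path_alg k Q :=
  \sum_(p <- msupp x) \sum_(q <- msupp y) (x@_p * y@_q) *: pmul k p q.
Arguments path_mul {k Q} x y.

Section PathAlgebra.
Variables (k : fieldType) (Q : quiver).
Local Notation path_alg := (path_alg k Q).
Local Notation path_mul := (@path_mul k Q).
Local Notation pbasis := (@pbasis k Q).
Local Notation pmul := (@pmul k Q).
Implicit Types x y z : path_alg.

Definition path_one : path_alg := \sum_(v : vertex Q) pbasis (vpath v).

Lemma pbasisE (x : path_alg) : x = \sum_(p <- msupp x) x@_p *: pbasis p.
Proof. by rewrite pbasis.unlock; apply: malg_basisE. Qed.

Lemma path_mulEl x y : path_mul x y =
  \sum_(p <- msupp x) x@_p *: \sum_(q <- msupp y) y@_q *: pmul p q.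
Proof.
rewrite path_mul.unlock; apply: eq_bigr => p _; rewrite scaler_sumr.
by apply: eq_bigr => q _; rewrite scalerA.
Qed.

Lemma path_mulEr x y : path_mul x y =
  \sum_(q <- msupp y) y@_q *: \sum_(p <- msupp x) x@_p *: pmul p q.
Proof.
rewrite path_mul.unlock exchange_big; apply: eq_bigr => q _; rewrite scaler_sumr.
by apply: eq_bigr => p _; rewrite scalerA mulrC.
Qed.

Lemma path_mulEE x y : path_mul x y =
  \sum_(p <- msupp x) \sum_(q <- msupp y) (x@_p * y@_q) *: pmul p q.
Proof. by rewrite path_mul.unlock. Qed.

Lemma path_mul_linl y : linear (path_mul^~ y).
Proof.
move=> a x x'; rewrite /= !path_mulEl.
exact: (linext_linear (fun p => \sum_(q <- msupp y) y@_q *: pmul p q)).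
Qed.

Lemma path_mul_linr x : linear (path_mul x).
Proof.
move=> a y y'; rewrite /= !path_mulEr.
exact: (linext_linear (fun q => \sum_(p <- msupp x) x@_p *: pmul p q)).
Qed.

Lemma path_mul0l y : path_mul 0 y = 0.
Proof. exact: lin0 (path_mul_linl y). Qed.
Lemma path_mul0r x : path_mul x 0 = 0.
Proof. exact: lin0 (path_mul_linr x). Qed.
Lemma path_mulPl a x x' y :
  path_mul (a *: x + x') y = a *: path_mul x y + path_mul x' y.
Proof. exact: path_mul_linl. Qed.
Lemma path_mulPr a x y y' :
  path_mul x (a *: y + y') = a *: path_mul x y + path_mul x y'.
Proof. exact: path_mul_linr. Qed.

Lemma msupp_pbasis p : msupp (pbasis p) = [fset p]%fset.
Proof. by rewrite pbasis.unlock msuppU oner_eq0. Qed.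

Lemma mcoeff_pbasis p q : (pbasis p)@_q = (p == q)%:R.
Proof. by rewrite pbasis.unlock mcoeffU. Qed.

Lemma path_mul_basis p q : path_mul (pbasis p) (pbasis q) = pmul p q.
Proof.
rewrite path_mulEl msupp_pbasis big_seq_fset1 msupp_pbasis big_seq_fset1.
by rewrite !mcoeff_pbasis !eqxx !scale1r.
Qed.

Lemma path_alg_ind (P : path_alg -> Prop) :
  P 0 -> (forall a x y, P x -> P y -> P (a *: x + y)) ->
  (forall p, P (pbasis p)) -> forall x, P x.
Proof.
move=> P0 PD Pb x; rewrite [x]pbasisE; elim: (enum_fset _) => [|p s IHs].
  by rewrite big_nil.
by rewrite big_cons; apply: PD.
Qed.

Lemma pmulA p q r : path_mul (pbasis p) (pmul q r) = path_mul (pmul p q) (pbasis r).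
Proof.
rewrite /pmul; have := pcatA p q r.
case: (pcat p q) (pcat q r) => [x|] [y|]; rewrite /= ?path_mul0l ?path_mul0r //.
- by rewrite !path_mul_basis /pmul => ->.
- by rewrite path_mul_basis /pmul => ->.
- by rewrite path_mul_basis /pmul => <-.
Qed.

Fact path_mulA : associative path_mul.
Proof.
move=> x y z; elim/path_alg_ind: x => [|a x x' IHx IHx'|p].
- by rewrite !path_mul0l.
- by rewrite !path_mulPl IHx IHx'.
elim/path_alg_ind: y => [|a y y' IHy IHy'|q].
- by rewrite path_mul0l !path_mul0r path_mul0l.
- by rewrite path_mulPl !path_mulPr path_mulPl IHy IHy'.
elim/path_alg_ind: z => [|a z z' IHz IHz'|r].
- by rewrite !path_mul0r.
- by rewrite !path_mulPr IHz IHz'.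
by rewrite !path_mul_basis pmulA.
Qed.

Fact path_mul1x : left_id path_one path_mul.
Proof.
move=> x; elim/path_alg_ind: x => [|a y y' IHy IHy'|q].
- exact: path_mul0r.
- by rewrite path_mulPr IHy IHy'.
rewrite (lin_sum (path_mul_linl _)) (bigD1 (psource q)) //=.
rewrite path_mul_basis /pmul pcat_vl eqxx /= big1 ?addr0 // => v /negPf nv.
by rewrite path_mul_basis /pmul pcat_vl nv.
Qed.

Fact path_mulx1 : right_id path_one path_mul.
Proof.
move=> x; elim/path_alg_ind: x => [|a y y' IHy IHy'|q].
- exact: path_mul0l.
- by rewrite path_mulPl IHy IHy'.
rewrite (lin_sum (path_mul_linr _)) (bigD1 (ptarget q)) //=.
rewrite path_mul_basis /pmul pcat_vr eqxx /= big1 ?addr0 // => v /negPf nv.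
by rewrite path_mul_basis /pmul pcat_vr nv.
Qed.

Fact path_mulDl : left_distributive path_mul +%R.
Proof. by move=> x y z; exact: (linD (path_mul_linl z)). Qed.
Fact path_mulDr : right_distributive path_mul +%R.
Proof. by move=> x y z; exact: (linD (path_mul_linr x)). Qed.

Lemma mcoeff_path_one v : path_one@_(vpath v) = 1.
Proof.
rewrite /path_one raddf_sum /= (bigD1 v) //= mcoeff_pbasis eqxx.
rewrite big1 ?addr0 // => w nw.
rewrite mcoeff_pbasis; case: eqP => // /(congr1 (@psource Q)) /eqP.
by rewrite (negPf nw).
Qed.

Fact path_oner_neq0 : path_one != 0.
Proof.
have /card_gt0P[v _] := vertex_gt0 Q; apply: contraNneq (oner_neq0 k) => e.
by rewrite -(mcoeff_path_one v) e mcoeff0.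
Qed.

HB.instance Definition _ := GRing.Zmodule_isNzRing.Build path_alg
  path_mulA path_mul1x path_mulx1 path_mulDl path_mulDr path_oner_neq0.

Fact path_scaleAl (a : k) (x y : path_alg) : a *: (x * y) = (a *: x) * y.
Proof. exact/esym/(linZ (path_mul_linl y)). Qed.
HB.instance Definition _ := GRing.Lmodule_isLalgebra.Build k path_alg path_scaleAl.
Fact path_scaleAr (a : k) (x y : path_alg) : a *: (x * y) = x * (a *: y).
Proof. exact/esym/(linZ (path_mul_linr x)). Qed.
HB.instance Definition _ := GRing.Lalgebra_isAlgebra.Build k path_alg path_scaleAr.

Definition path_algebra : algType k := GRing.Algebra.clone k path_alg _.

Definition arrow_ideal : path_alg -> Prop :=
  ideal_gen (fun x => exists a : arrow Q, x = pbasis (apath a)).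

Definition admissible_bounds (I : path_alg -> Prop) : Prop :=
  exists n : nat, [/\ (2 <= n)%N,
    forall x, ideal_pow arrow_ideal n x -> I x &
    forall x, I x -> ideal_pow arrow_ideal 2 x].

Lemma path_mulE p q : pbasis p * pbasis q = pmul p q.
Proof. exact: path_mul_basis. Qed.

Lemma arrow_ideal_mcoeff v x : arrow_ideal x -> x@_(vpath v) = 0.
Proof.
pose J y := forall w, y@_(vpath w) = 0.
have JM p q r : ~~ nilp (parrows p) || ~~ nilp (parrows q) ->
  (pmul p q)@_(vpath r) = 0.
  move=> h; rewrite /pmul; case: pcatP => [s _ _ es _|_] /=; last by rewrite mcoeff0.
  rewrite mcoeff_pbasis; case: eqP => // sr; move: h; move: es; rewrite sr /=.
  by case: (parrows p) => //; case: (parrows q).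
have Jb y : J y -> forall p, p \in msupp y -> ~~ nilp (parrows p).
  move=> Jy p; rewrite -mcoeff_neq0; apply: contraNN => /nilP ep.
  by rewrite (_ : p = vpath (psource p)) ?Jy //; apply: qpath_inj.
suff hJ : two_sided_ideal J.
  move=> /(_ J hJ) h; apply: h => y [a ->] w; rewrite mcoeff_pbasis.
  by case: eqP => // /(congr1 (@parrows Q)).
split=> [w|y z Jy Jz w|a y Jy]; first by rewrite mcoeff0.
  by rewrite mcoeffD Jy Jz addr0.
split=> w; rewrite [_ * _]path_mulEE raddf_sum big_seq big1 //= => p hp;
  rewrite raddf_sum big_seq big1 //= => q hq; rewrite mcoeffZ JM ?mulr0 //.
  by rewrite (Jb _ Jy _ hq) orbT.
by rewrite (Jb _ Jy _ hp).
Qed.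

Lemma arrow_pow_path n p : (n <= size (parrows p))%N ->
  ideal_pow arrow_ideal n (pbasis p).
Proof.
elim: n p => [|n IHn] p //=; case: p => [[v [|a s]] //= h] /= ns.
have /andP[/eqP sa wk] := h.
pose q : qpath Q := @QPath _ (target a, s) wk.
have -> : pbasis (@QPath Q (v, a :: s) h) = pbasis (apath a) * pbasis q.
  rewrite path_mulE /pmul; case: pcatP => [r _ e1 e2 _|] //=.
  by congr pbasis; apply: qpath_inj; rewrite ?e1 ?e2 /psource /=.
apply: ideal_mul_in; first by apply: ideal_gen_sub; exists a.
by apply: IHn; rewrite /parrows.
Qed.

End PathAlgebra.

Section BoundQuiverAlgebra.
Variables (k : fieldType) (Q : quiver).

Record admissible_ideal := AdmissibleIdeal {
  adm_set :> path_alg k Q -> Prop;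
  adm_ideal : two_sided_ideal adm_set;
  adm_bounds : admissible_bounds adm_set }.

Variable I : admissible_ideal.

Fact adm_proper : ~ I 1.
Proof.
have [n [_ _ IF2]] := adm_bounds I => /IF2 [s hs e1].
have [_ _ FM] := ideal_gen_ideal
  (fun x : path_alg k Q => exists a : arrow Q, x = pbasis k (apath a)).
have /card_gt0P[v _] := vertex_gt0 Q; have /eqP[] := oner_neq0 k.
rewrite -(mcoeff_path_one k v) [path_one _ _]e1 raddf_sum big_seq big1 //= => p /hs[Fp _].
by apply: arrow_ideal_mcoeff; apply: (FM _ _ Fp).2.
Qed.

Definition adm_proper_ideal : proper_ideal (path_alg k Q) :=
  ProperIdeal (adm_ideal I) adm_proper.

Definition bqa : Type := aquot adm_proper_ideal.
HB.instance Definition _ := GRing.Algebra.on bqa.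
Definition bqa_pi : path_alg k Q -> bqa := @aquot_pi _ _ adm_proper_ideal.
HB.instance Definition _ := GRing.LRMorphism.on bqa_pi.
Definition bqa_repr : bqa -> path_alg k Q := @aquot_repr _ _ adm_proper_ideal.
Lemma bqa_reprK x : bqa_pi (bqa_repr x) = x.
Proof. exact: aquot_reprK. Qed.
Lemma bqa_pi_eq x y : bqa_pi x = bqa_pi y <-> I (x - y).
Proof. exact: aquot_pi_eq. Qed.
Lemma bqa_pi0 x : bqa_pi x = 0 <-> I x.
Proof. exact: aquot_pi0. Qed.

Fact bqa_vect_iso :
  exists m : nat, exists2 h : bqa -> 'rV[k]_m, linear h & bijective h.
Proof.
have [n [_ FI _]] := adm_bounds I.
pose s : seq (qpath Q) := pmap insub (flatten [seq [seq (v, val t) |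
   v <- enum (vertex Q), t <- enum {: l.-tuple (arrow Q)}] | l <- iota 0 n]).
have sP p : (size (parrows p) < n)%N -> p \in s.
  move=> lt; rewrite mem_pmap_sub /=; apply/flattenP.
  exists [seq (v, val t) | v <- enum (vertex Q),
     t <- enum {: (size (parrows p)).-tuple (arrow Q)}].
    by apply/mapP; exists (size (parrows p)); rewrite ?mem_iota.
  apply/allpairsP; exists (psource p, in_tuple (parrows p)).
  by rewrite !mem_enum; split=> //; rewrite /psource /parrows; case: (qpath_val p).
pose g (x : 'rV[k]_(size s)) : bqa := \sum_(i < size s) x 0 i *: bqa_pi (pbasis k (tnth (in_tuple s) i)).
have glin : linear g.
  move=> a x y; rewrite scaler_sumr -big_split; apply: eq_bigr => i _ /=.
  by rewrite !mxE scalerDl scalerA.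
apply: (fg_vect_iso glin) => v; rewrite -[v]bqa_reprK.
elim/path_alg_ind: (bqa_repr v) => [|a x y [x' ex] [y' ey]|p].
- by exists 0; rewrite linear0 /g big1 // => i _; rewrite mxE scale0r.
- by exists (a *: x' + y'); rewrite glin ex ey linearP.
have [lt|ge] := ltnP (size (parrows p)) n; last first.
  exists 0; rewrite (bqa_pi0 _).2 ?/g ?big1 // => [i _|]; first by rewrite mxE scale0r.
  exact/FI/arrow_pow_path.
have ps := sP p lt; have ix : (index p s < size s)%N by rewrite index_mem.
exists (delta_mx 0 (Ordinal ix)); rewrite /g (bigD1 (Ordinal ix)) //= big1 ?addr0.
  by rewrite mxE !eqxx scale1r (tnth_nth p) nth_index.
by move=> j /negPf nj; rewrite mxE nj andbF scale0r.
Qed.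
HB.instance Definition _ := Lmodule_hasFinDim.Build k bqa
  (let: exist2 h a b := cid2 (svalP (cid bqa_vect_iso)) in exist2 _ _ h a b).
HB.instance Definition _ := Algebra_isFalgebra.Build k bqa.

Definition bound_quiver_algebra : falgType k := Falgebra.clone k bqa _.

Fact adm_square_ideal : two_sided_ideal (ideal_mul I I).
Proof. by apply: ideal_mul_ideal; exact: adm_ideal. Qed.

Fact adm_square_bounds : admissible_bounds (ideal_mul I I).
Proof.
have [n [n2 FI IF]] := adm_bounds I; exists (n + n)%N; split.
- exact: leq_trans n2 (leq_addr _ _).
- move=> x /ideal_powD[s hs ->]; exists s => // p /hs[h1 h2].
  by split; apply: FI.
move=> x [s hs ->]; apply: IF.
have [I0 ID IM] := adm_ideal I.
elim: s hs => [|p s IHs] hs; first by rewrite big_nil.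
rewrite big_cons; apply: ID.
  by have [_ Ip] := hs p (mem_head _ _); apply: (IM _ _ Ip).1.
by apply: IHs => q qs; apply: hs; rewrite inE qs orbT.
Qed.

Definition adm_square : admissible_ideal :=
  AdmissibleIdeal adm_square_ideal adm_square_bounds.

End BoundQuiverAlgebra.

Section EnvelopingAlgebra.
Variables (k : fieldType) (L : falgType k).

(* The elements of L ⊗ L^op are represented by their coordinates in the basis
   (b_i ⊗ b_j), where (b_i) is the basis [vbasis fullv] of L. *)
Definition env : Type := 'M[k]_(\dim {:L}, \dim {:L}).
HB.instance Definition _ := Vector.copy env 'M[k]_(\dim {:L}, \dim {:L}).

Local Notation e := (vbasis {:L}).

Definition tens (a b : L) : env := \matrix_(i, j) (coord e i a * coord e j b).

Definition env_mul (M N : env) : env :=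
  \sum_i \sum_j \sum_p \sum_q
    (M i j * N p q) *: tens (e`_i * e`_p) (e`_q * e`_j).

Lemma tens_linl b : linear (tens^~ b).
Proof.
by move=> a x y; apply/matrixP => i j; rewrite !mxE linearP mulrDl mulrA.
Qed.
Lemma tens_linr a : linear (tens a).
Proof.
move=> c x y; apply/matrixP => i j.
by rewrite !mxE linearP mulrDr mulrCA.
Qed.

Lemma vbasis_coordE (a : L) : a = \sum_i coord e i a *: e`_i.
Proof. exact: coord_vbasis (memvf a). Qed.

Lemma coord_vbasis_nth (i j : 'I_(\dim {:L})) : coord e i e`_j = (i == j)%:R.
Proof. by rewrite coord_free ?(basis_free (vbasisP _)) // eq_sym. Qed.

Lemma env_tensE (M : env) : M = \sum_i \sum_j M i j *: tens e`_i e`_j.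
Proof.
apply/matrixP => r c; rewrite summxE (bigD1 r) //= summxE (bigD1 c) //= !mxE.
rewrite !coord_vbasis_nth !eqxx !mulr1 big1 => [|j /negPf nj]; last first.
  by rewrite !mxE !coord_vbasis_nth [c == j]eq_sym nj !mulr0.
rewrite addr0 big1 ?addr0 // => i /negPf ni; rewrite summxE big1 // => j _.
by rewrite !mxE !coord_vbasis_nth [r == i]eq_sym ni mul0r mulr0.
Qed.

Lemma env_mul_linl N : linear (env_mul^~ N).
Proof.
move=> a M M'; rewrite /env_mul !(scaler_sumr, =^~ big_split) /=.
do 4![rewrite ?scaler_sumr -?big_split; apply: eq_bigr => ? _ /=].
by rewrite !mxE mulrDl scalerDl scalerA mulrA.
Qed.

Lemma env_mul_linr M : linear (env_mul M).
Proof.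
move=> a N N'; rewrite /env_mul.
do 4![rewrite ?scaler_sumr -?big_split; apply: eq_bigr => ? _ /=].
by rewrite !mxE mulrDr scalerDl scalerA mulrCA.
Qed.

Lemma env_ind (P : env -> Prop) :
  P 0 -> (forall a x y, P x -> P y -> P (a *: x + y)) ->
  (forall a b, P (tens a b)) -> forall M, P M.
Proof.
move=> P0 PD Pt M; rewrite [M]env_tensE.
have PA x y : P x -> P y -> P (x + y) by rewrite -{2}[x]scale1r; apply: PD.
have PZ a x : P x -> P (a *: x) by move=> Px; rewrite -[_ *: _]addr0; apply: PD.
by elim/big_ind: _ => // i _; elim/big_ind: _ => // j _; apply: PZ.
Qed.

Lemma env_mul_tens a b c d :
  env_mul (tens a b) (tens c d) = tens (a * c) (d * b).
Proof.
have A u w : tens (a * u) w = \sum_i coord e i a *: tens (e`_i * u) w.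
  rewrite {1}[a]vbasis_coordE mulr_suml (lin_sum (tens_linl w)).
  by apply: eq_bigr => i _; rewrite -scalerAl (linZ (tens_linl w)).
have B u w : tens w (u * b) = \sum_i coord e i b *: tens w (u * e`_i).
  rewrite {1}[b]vbasis_coordE mulr_sumr (lin_sum (tens_linr w)).
  by apply: eq_bigr => i _; rewrite -scalerAr (linZ (tens_linr w)).
have C u w : tens (u * c) w = \sum_i coord e i c *: tens (u * e`_i) w.
  rewrite {1}[c]vbasis_coordE mulr_sumr (lin_sum (tens_linl w)).
  by apply: eq_bigr => i _; rewrite -scalerAr (linZ (tens_linl w)).
have D u w : tens w (d * u) = \sum_i coord e i d *: tens w (e`_i * u).
  rewrite {1}[d]vbasis_coordE mulr_suml (lin_sum (tens_linr w)).
  by apply: eq_bigr => i _; rewrite -scalerAl (linZ (tens_linr w)).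
rewrite A /env_mul; apply: eq_bigr => i _; rewrite B scaler_sumr.
apply: eq_bigr => j _; rewrite C !scaler_sumr.
apply: eq_bigr => p _; rewrite D !scaler_sumr.
by apply: eq_bigr => q _; rewrite !scalerA !mxE !mulrA.
Qed.

Lemma env_mul0l y : env_mul 0 y = 0.
Proof. exact: lin0 (env_mul_linl y). Qed.
Lemma env_mul0r x : env_mul x 0 = 0.
Proof. exact: lin0 (env_mul_linr x). Qed.
Lemma env_mulPl a x x' y :
  env_mul (a *: x + x') y = a *: env_mul x y + env_mul x' y.
Proof. exact: env_mul_linl. Qed.
Lemma env_mulPr a x y y' :
  env_mul x (a *: y + y') = a *: env_mul x y + env_mul x y'.
Proof. exact: env_mul_linr. Qed.

Fact env_mulA : associative env_mul.
Proof.
move=> x y z; elim/env_ind: x => [|a x x' IHx IHx'|a b].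
- by rewrite !env_mul0l.
- by rewrite !env_mulPl IHx IHx'.
elim/env_ind: y => [|c y y' IHy IHy'|c d].
- by rewrite env_mul0l !env_mul0r env_mul0l.
- by rewrite env_mulPl !env_mulPr env_mulPl IHy IHy'.
elim/env_ind: z => [|f z z' IHz IHz'|f g].
- by rewrite !env_mul0r.
- by rewrite !env_mulPr IHz IHz'.
by rewrite !env_mul_tens !mulrA.
Qed.

Fact env_mul1x : left_id (tens 1 1) env_mul.
Proof.
move=> x; elim/env_ind: x => [|a x x' IHx IHx'|a b].
- exact: env_mul0r.
- by rewrite env_mulPr IHx IHx'.
by rewrite env_mul_tens mul1r mulr1.
Qed.

Fact env_mulx1 : right_id (tens 1 1) env_mul.
Proof.
move=> x; elim/env_ind: x => [|a x x' IHx IHx'|a b].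
- exact: env_mul0l.
- by rewrite env_mulPl IHx IHx'.
by rewrite env_mul_tens mul1r mulr1.
Qed.

Fact env_mulDl : left_distributive env_mul +%R.
Proof. by move=> x y z; exact: (linD (env_mul_linl z)). Qed.
Fact env_mulDr : right_distributive env_mul +%R.
Proof. by move=> x y z; exact: (linD (env_mul_linr x)). Qed.

Fact env_oner_neq0 : tens 1 1 != 0.
Proof.
have [i ni] : exists i, coord e i (1 : L) != 0.
  apply/existsP; apply: contraNT (oner_neq0 L) => /existsPn h.
  rewrite [1]vbasis_coordE big1 // => i _.
  by have /negPn/eqP-> := h i; rewrite scale0r.
apply: contraNneq ni => /matrixP/(_ i i)/eqP.
by rewrite !mxE mulf_eq0 orbb.
Qed.

HB.instance Definition _ := GRing.Zmodule_isNzRing.Build env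
  env_mulA env_mul1x env_mulx1 env_mulDl env_mulDr env_oner_neq0.
Fact env_scaleAl (a : k) (x y : env) : a *: (x * y) = (a *: x) * y.
Proof. exact/esym/(linZ (env_mul_linl y)). Qed.
HB.instance Definition _ := GRing.Lmodule_isLalgebra.Build k env env_scaleAl.
Fact env_scaleAr (a : k) (x y : env) : a *: (x * y) = x * (a *: y).
Proof. exact/esym/(linZ (env_mul_linr x)). Qed.
HB.instance Definition _ := GRing.Lalgebra_isAlgebra.Build k env env_scaleAr.
HB.instance Definition _ := Algebra_isFalgebra.Build k env.

Definition env_alg : falgType k := Falgebra.clone k env _.

Lemma tensM a b c d : tens a b * tens c d = tens (a * c) (d * b).
Proof. exact: env_mul_tens. Qed.
Lemma tens1 : tens 1 1 = 1. Proof. by []. Qed.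

End EnvelopingAlgebra.

Section Modules.
Variables (k : fieldType) (A : algType k).

(* Finite-dimensional modules; over a finite-dimensional algebra these are the
   finitely generated ones. *)
Record lmodule := LModule {
  lmod_vect :> vectType k;
  lact : A -> lmod_vect -> lmod_vect;
  lact_linearl : forall x, linear (lact^~ x);
  lact_linearr : forall a, linear (lact a);
  lact1 : forall x, lact 1 x = x;
  lactM : forall a b x, lact (a * b) x = lact a (lact b x) }.

Record rmodule := RModule {
  rmod_vect :> vectType k;
  ract : rmod_vect -> A -> rmod_vect;
  ract_linearl : forall a, linear (ract^~ a);
  ract_linearr : forall x, linear (ract x);
  ract1 : forall x, ract x 1 = x;
  ractM : forall x a b, ract x (a * b) = ract (ract x a) b }.

Record bimodule := Bimodule {
  bimod_left :> lmodule;
  bact : bimod_left -> A -> bimod_left;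
  bact_linearl : forall a, linear (bact^~ a);
  bact_linearr : forall x, linear (bact x);
  bact1 : forall x, bact x 1 = x;
  bactM : forall x a b, bact x (a * b) = bact (bact x a) b;
  lact_bact : forall a x b, lact a (bact x b) = bact (lact a x) b }.

Definition is_lhom (M N : lmodule) (f : 'Hom(M, N)) : Prop :=
  forall a x, f (lact a x) = lact a (f x).

Definition is_bihom (M N : bimodule) (f : 'Hom(M, N)) : Prop :=
  is_lhom f /\ forall x a, f (bact x a) = bact (f x) a.

Fact lhom_submod M N : submod_prop (@is_lhom M N).
Proof.
split=> [a x|c f g hf hg a x].
  by rewrite !zero_lfunE (lin0 (lact_linearr a)).
by rewrite !add_lfunE !scale_lfunE hf hg lact_linearr.
Qed.

Fact bihom_submod M N : submod_prop (@is_bihom M N).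
Proof.
have [h0 hl] := lhom_submod M N.
split=> [|c f g [fl fr] [gl gr]].
  by split=> // x a; rewrite !zero_lfunE (lin0 (bact_linearl a)).
split=> [|x a]; first exact: hl.
by rewrite !add_lfunE !scale_lfunE fr gr bact_linearl.
Qed.

Definition lhoms (M N : lmodule) : {vspace 'Hom(M, N)} :=
  vspace_of (lhom_submod M N).
Definition LHom (M N : lmodule) : vectType k := subvs_of (lhoms M N).

Definition bihoms (M N : bimodule) : {vspace 'Hom(M, N)} :=
  vspace_of (bihom_submod M N).
Definition BiHom (M N : bimodule) : vectType k := subvs_of (bihoms M N).

Lemma mem_lhoms M N f : f \in lhoms M N <-> is_lhom f.
Proof. exact: mem_vspace_of. Qed.
Lemma mem_bihoms M N f : f \in bihoms M N <-> is_bihom f.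
Proof. exact: mem_vspace_of. Qed.

Definition lfun_of (M N : lmodule) (f : LHom M N) : 'Hom(M, N) := vsval f.
Definition bifun_of (M N : bimodule) (f : BiHom M N) : 'Hom(M, N) := vsval f.

Lemma LHomP M N (f : LHom M N) : is_lhom (lfun_of f).
Proof. by apply/mem_lhoms; apply: subvsP. Qed.

Lemma LHom_eq M N (f g : LHom M N) : (forall x, lfun_of f x = lfun_of g x) -> f = g.
Proof. by move=> h; apply: val_inj; apply/lfunP. Qed.

Lemma lfun_of_lin M N c (f g : LHom M N) x :
  lfun_of (c *: f + g) x = c *: lfun_of f x + lfun_of g x.
Proof. by rewrite /lfun_of linearP add_lfunE scale_lfunE. Qed.

Lemma lfun_ofK (M N : lmodule) (f : 'Hom(M, N)) :
  is_lhom f -> lfun_of (vsproj (lhoms M N) f) = f.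
Proof. by move=> h; rewrite /lfun_of vsprojK //; apply/mem_lhoms. Qed.

Section Precomposition.
Variables (M' M N : lmodule) (d : LHom M' M).

Definition precomp_fun (f : LHom M N) : LHom M' N :=
  vsproj (lhoms M' N) (lfun_of f \o lfun_of d)%VF.

Lemma precomp_lhom f : is_lhom (lfun_of f \o lfun_of d : 'Hom(M', N))%VF.
Proof. by move=> a x; rewrite !comp_lfunE !LHomP. Qed.

Lemma precomp_funE f x : lfun_of (precomp_fun f) x = lfun_of f (lfun_of d x).
Proof. by rewrite /precomp_fun lfun_ofK ?comp_lfunE //; apply: precomp_lhom. Qed.

Fact precomp_linear : linear precomp_fun.
Proof. by move=> c f g; apply: LHom_eq => x; rewrite !(precomp_funE, lfun_of_lin). Qed.
HB.instance Definition _ :=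
  GRing.isLinear.Build k (LHom M N) (LHom M' N) _ precomp_fun precomp_linear.

Definition precomp : 'Hom(LHom M N, LHom M' N) := linfun precomp_fun.

Lemma precompE f x : lfun_of (precomp f) x = lfun_of f (lfun_of d x).
Proof. by rewrite /precomp lfunE /= precomp_funE. Qed.
End Precomposition.

Definition projective (P : lmodule) : Prop :=
  forall (X Y : lmodule) (g : LHom X Y) (f : LHom P Y),
    limg (lfun_of g) = fullv ->
    exists h : LHom P X, (lfun_of g \o lfun_of h = lfun_of f)%VF.

(* [p] maps its source onto the submodule [U] of [M], and is an essential
   epimorphism onto it *)
Definition essential_onto (P M : lmodule) (p : LHom P M) (U : {vspace M}) :=
  limg (lfun_of p) = U /\
  forall (X : lmodule) (g : LHom X P),
    limg (lfun_of p \o lfun_of g) = U -> limg (lfun_of g) = fullv.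

Record min_proj_pres (M : lmodule) := MinProjPres {
  pres1 : lmodule;
  pres0 : lmodule;
  pres_d1 : LHom pres1 pres0;
  pres_d0 : LHom pres0 M;
  pres1_proj : projective pres1;
  pres0_proj : projective pres0;
  pres0_cover : essential_onto pres_d0 fullv;
  pres1_cover : essential_onto pres_d1 (lker (lfun_of pres_d0)) }.

Record proj_resolution (M : lmodule) := ProjResolution {
  res_obj : nat -> lmodule;
  res_d : forall n, LHom (res_obj n.+1) (res_obj n);
  res_aug : LHom (res_obj 0) M;
  res_proj : forall n, projective (res_obj n);
  res_aug_onto : limg (lfun_of res_aug) = fullv;
  res_exact0 : limg (lfun_of (res_d 0)) = lker (lfun_of res_aug);
  res_exact : forall n, limg (lfun_of (res_d n.+1)) = lker (lfun_of (res_d n)) }.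

Section Ext.
Variables (M : lmodule) (P : proj_resolution M) (N : lmodule).

Definition cochain (n : nat) : vectType k := LHom (res_obj P n) N.
Definition codiff (n : nat) : 'Hom(cochain n, cochain n.+1) :=
  precomp N (res_d P n).
Definition cocycles (n : nat) : {vspace cochain n} := lker (codiff n).
Definition coboundaries (n : nat) : {vspace cochain n} :=
  if n is m.+1 then limg (codiff m) else 0%VS.

(* [Ext n] is Ext^n_A(M, N), computed from the resolution P: the quotient of
   cocycles by coboundaries. *)
Definition Ext (n : nat) : vectType k :=
  vquot (linfun (vsval : subvs_of (cocycles n) -> cochain n)
           @^-1: coboundaries n)%VS.

Definition Ext_class (n : nat) : subvs_of (cocycles n) -> Ext n :=
  vquot_pi (linfun (vsval : subvs_of (cocycles n) -> cochain n)
           @^-1: coboundaries n)%VS.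

End Ext.

End Modules.

Section RightModules.
Variables (k : fieldType) (A : algType k) (M : rmodule A).

Section Quotient.
Variable U : {vspace M}.
Hypothesis hU : forall x a, x \in U -> ract x a \in U.

Definition rquot_act (x : vquot U) (a : A) : vquot U :=
  vquot_pi U (ract (vquot_repr x) a).

Lemma rquot_act_pi x a : rquot_act (vquot_pi U x) a = vquot_pi U (ract x a).
Proof.
apply/vquot_pi_eq; rewrite -(linB (ract_linearl a)); apply: hU.
by apply/vquot_pi_eq; rewrite vquot_reprK.
Qed.

Fact rquot_linearl a : linear (rquot_act^~ a).
Proof.
move=> c x y; rewrite -[x]vquot_reprK -[y]vquot_reprK -linearP.
by rewrite !rquot_act_pi ract_linearl linearP.
Qed.
Fact rquot_linearr x : linear (rquot_act x).
Proof.
by move=> c a b; rewrite -[x]vquot_reprK !rquot_act_pi ract_linearr linearP.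
Qed.
Fact rquot_act1 x : rquot_act x 1 = x.
Proof. by rewrite -[x]vquot_reprK rquot_act_pi ract1. Qed.
Fact rquot_actM x a b : rquot_act x (a * b) = rquot_act (rquot_act x a) b.
Proof. by rewrite -[x]vquot_reprK !rquot_act_pi ractM. Qed.

Definition rquot : rmodule A :=
  RModule rquot_linearl rquot_linearr rquot_act1 rquot_actM.
End Quotient.

(* The left module D M = Hom_k(M, k) of a right module M: (a f)(x) = f (x a) *)
Definition ract_lfun (a : A) : 'End(M) := linfun (@ract _ _ M ^~ a).

Lemma ract_lfunE a x : ract_lfun a x = ract x a.
Proof.
pose m := GRing.isLinear.Build _ _ _ _ (@ract _ _ M ^~ a) (ract_linearl a).
pose f : {linear M -> M} := HB.pack (@ract _ _ M ^~ a) m.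
exact: (lfunE f).
Qed.

Definition rdual_act (a : A) (f : 'Hom(M, k^o)) : 'Hom(M, k^o) :=
  (f \o ract_lfun a)%VF.

Fact rdual_linearl f : linear (rdual_act^~ f).
Proof.
move=> c a b; apply/lfunP => x; rewrite add_lfunE scale_lfunE !comp_lfunE.
by rewrite !ract_lfunE ract_linearr linearP.
Qed.
Fact rdual_linearr a : linear (rdual_act a).
Proof. by move=> c f g; rewrite /rdual_act comp_lfunDl comp_lfunZl. Qed.
Fact rdual_act1 f : rdual_act 1 f = f.
Proof. by apply/lfunP => x; rewrite comp_lfunE ract_lfunE ract1. Qed.
Fact rdual_actM a b f : rdual_act (a * b) f = rdual_act a (rdual_act b f).
Proof. by apply/lfunP => x; rewrite !comp_lfunE !ract_lfunE ractM. Qed.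

Definition rdual : lmodule A :=
  LModule rdual_linearl rdual_linearr rdual_act1 rdual_actM.

End RightModules.

Section AuslanderReiten.
Variables (k : fieldType) (A : falgType k).

Fact reg_linearl (x : A) : linear ( *%R^~ x).
Proof. by move=> c a b; rewrite mulrDl scalerAl. Qed.
Fact reg_linearr (a : A) : linear ( *%R a).
Proof. by move=> c x y; rewrite mulrDr scalerAr. Qed.
Fact reg_actM (a b x : A) : a * b * x = a * (b * x).
Proof. exact/esym/mulrA. Qed.

Definition reg_lmodule : lmodule A :=
  @LModule k A A *%R reg_linearl reg_linearr (@mul1r A) reg_actM.

Definition reg_mulr (a : A) : 'End(reg_lmodule) := amulr a.
Lemma reg_mulrE a (x : reg_lmodule) : reg_mulr a x = (x : A) * a.
Proof. exact: lfunE. Qed.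

(* Hom_A(P, A) is a right A-module: (f a)(x) = f(x) a *)
Section Star.
Variable P : lmodule A.

Definition star_act (f : LHom P reg_lmodule) (a : A) : LHom P reg_lmodule :=
  vsproj (lhoms P reg_lmodule) (reg_mulr a \o lfun_of f)%VF.

Lemma star_actE f a x : lfun_of (star_act f a) x = (lfun_of f x : A) * a.
Proof.
rewrite /star_act lfun_ofK ?comp_lfunE ?reg_mulrE // => b y.
by rewrite !comp_lfunE !reg_mulrE LHomP /= mulrA.
Qed.

Fact star_linearl a : linear (star_act^~ a).
Proof.
move=> c f g; apply: LHom_eq => x; rewrite !(star_actE, lfun_of_lin).
by rewrite mulrDl scalerAl.
Qed.
Fact star_linearr f : linear (star_act f).
Proof.
move=> c a b; apply: LHom_eq => x; rewrite !(star_actE, lfun_of_lin).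
by rewrite mulrDr scalerAr.
Qed.
Fact star_act1 f : star_act f 1 = f.
Proof. by apply: LHom_eq => x; rewrite star_actE mulr1. Qed.
Fact star_actM f a b : star_act f (a * b) = star_act (star_act f a) b.
Proof. by apply: LHom_eq => x; rewrite !star_actE mulrA. Qed.

Definition star : rmodule A :=
  RModule star_linearl star_linearr star_act1 star_actM.
End Star.

Variables (M : lmodule A) (pres : min_proj_pres M).

Definition transpose_map : 'Hom(star (pres0 pres), star (pres1 pres)) :=
  precomp reg_lmodule (pres_d1 pres).

Fact transpose_stable (x : star (pres1 pres)) (a : A) :
  x \in limg transpose_map -> ract x a \in limg transpose_map.
Proof.
move=> /memv_imgP[f _ ->]; apply/memv_imgP; exists (star_act f a).
  exact: memvf.
by apply: LHom_eq => x'; rewrite star_actE !precompE star_actE.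
Qed.

Definition Tr : rmodule A := rquot transpose_stable.
Definition tau : lmodule A := rdual Tr.

End AuslanderReiten.

Section Hochschild.
Variables (k : fieldType) (L : falgType k).

Local Notation e := (vbasis {:L}).

(* (a ⊗ b) acts on L by x |-> a x b, see [biact_tens] *)
Definition biact (M : env L) (x : L) : L :=
  \sum_i \sum_j M i j *: (e`_i * x * e`_j).

Lemma biact_linearl x : linear (biact^~ x).
Proof.
move=> c M N; rewrite /biact.
do 2![rewrite ?scaler_sumr -?big_split; apply: eq_bigr => ? _ /=].
by rewrite !mxE scalerDl scalerA.
Qed.

Lemma biact_linearr M : linear (biact M).
Proof.
move=> c x y; rewrite /biact.
do 2![rewrite ?scaler_sumr -?big_split; apply: eq_bigr => ? _ /=].
by rewrite mulrDr mulrDl scalerDr -scalerAr -scalerAl !scalerA mulrC.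
Qed.

Lemma biact_tens a b x : biact (tens a b) x = a * x * b.
Proof.
rewrite {2}[a]vbasis_coordE {2}[b]vbasis_coordE !mulr_suml.
apply: eq_bigr => i _; rewrite mulr_sumr; apply: eq_bigr => j _.
by rewrite mxE -!scalerAl -scalerAr scalerA.
Qed.

Fact biact1 x : biact 1 x = x.
Proof. by rewrite -tens1 biact_tens mul1r mulr1. Qed.

Fact biactM M N x : biact (M * N) x = biact M (biact N x).
Proof.
elim/env_ind: M => [|c M M' IHM IHM'|a b].
- by rewrite mul0r !(lin0 (biact_linearl _)).
- by rewrite mulrDl -scalerAl !biact_linearl IHM IHM'.
elim/env_ind: N => [|c N N' IHN IHN'|c d].
- by rewrite mulr0 !(lin0 (biact_linearl _)) (lin0 (biact_linearr _)).
- by rewrite mulrDr -scalerAr !biact_linearl biact_linearr IHN IHN'.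
by rewrite tensM !biact_tens !mulrA.
Qed.

(* The bimodule L as a left module over the enveloping algebra *)
Definition reg_bimod : lmodule (env_alg L) :=
  @LModule k (env_alg L) L biact biact_linearl biact_linearr biact1 biactM.

Definition HH (P : proj_resolution reg_bimod) (n : nat) : vectType k :=
  Ext P reg_bimod n.

Definition HH1tau (pres : min_proj_pres reg_bimod) : vectType k :=
  'Hom(LHom reg_bimod (tau pres), k^o).

Definition excess (pres : min_proj_pres reg_bimod)
    (P : proj_resolution reg_bimod) : int :=
  (\dim {: HH1tau pres})%:Z - (\dim {: HH P 1})%:Z.

(* The first terms of a comparison from the bar resolution of L to [P]:
   [bc0], [bc1 a] and [bc2 a b] are the images of the generators 1 ⊗ 1,
   1 ⊗ a ⊗ 1 and 1 ⊗ a ⊗ b ⊗ 1 *)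
Record bar_comparison (P : proj_resolution reg_bimod) := BarComparison {
  bc0 : res_obj P 0;
  bc1 : L -> res_obj P 1;
  bc2 : L -> L -> res_obj P 2;
  bc1_linear : linear bc1;
  bc2_linearl : forall b, linear (bc2^~ b);
  bc2_linearr : forall a, linear (bc2 a);
  bc0_aug : lfun_of (res_aug P) bc0 = 1;
  bc1_diff : forall a, lfun_of (res_d P 0) (bc1 a) =
    lact (tens a 1) bc0 - lact (tens 1 a) bc0;
  bc2_diff : forall a b, lfun_of (res_d P 1) (bc2 a b) =
    lact (tens a 1) (bc1 b) - bc1 (a * b) + lact (tens 1 b) (bc1 a) }.

Lemma bar_comparison_exists (P : proj_resolution reg_bimod) :
  inhabited (bar_comparison P).
Proof.
pose d0 := lfun_of (res_d P 0); pose d1 := lfun_of (res_d P 1).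
pose ep := lfun_of (res_aug P).
have [u u1] : exists u, ep u = (1 : L).
  have : (1 : L) \in limg ep by rewrite [limg ep]res_aug_onto memvf.
  by move=> /memv_imgP[u _ ->]; exists u.
pose w0 a := lact (tens a 1) u - lact (tens 1 a) u.
have w0l : linear w0.
  move=> c a b; rewrite /w0 tens_linl tens_linr !lact_linearl.
  by rewrite scalerBr opprD addrACA.
have epact M x : ep (lact M x) = biact M (ep x) by exact: LHomP.
have epB x y : ep (x - y) = ep x - ep y by exact: linearB.
have w0K a : d0 (d0^-1%VF (w0 a)) = w0 a.
  rewrite limg_lfunVK // [limg d0]res_exact0 memv_ker -/ep; apply/eqP.
  by rewrite /w0 epB !epact u1 !biact_tens !mul1r !mulr1 subrr.
pose h1 a := d0^-1%VF (w0 a).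
have h1l : linear h1 by move=> c a b; rewrite /h1 w0l linearP.
have rearr (V : lmodType k) (c : k) (x y z x' y' z' : V) :
    c *: x + x' - (c *: y + y') + (c *: z + z')
    = c *: (x - y + z) + (x' - y' + z').
  by rewrite scalerDr scalerBr opprD [c *: x + x' + _]addrACA [LHS]addrACA.
pose w1 a b := lact (tens a 1) (h1 b) - h1 (a * b) + lact (tens 1 b) (h1 a).
have w1l b : linear (w1^~ b).
  move=> c a a'; rewrite /w1 tens_linl lact_linearl mulrDl -scalerAl !h1l.
  by rewrite lact_linearr; apply: rearr.
have w1r a : linear (w1 a).
  move=> c b b'; rewrite /w1 tens_linr lact_linearl mulrDr -scalerAr !h1l.
  by rewrite lact_linearr; apply: rearr.
have d0act M x : d0 (lact M x) = lact M (d0 x) by exact: LHomP.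
have d0B x y : d0 (x - y) = d0 x - d0 y by exact: linearB.
have d0D x y : d0 (x + y) = d0 x + d0 y by exact: linearD.
have w1K a b : d1 (d1^-1%VF (w1 a b)) = w1 a b.
  rewrite limg_lfunVK // [limg d1]res_exact memv_ker -/d0 /w1; apply/eqP.
  rewrite d0D d0B !d0act /h1 !w0K /w0 !(linB (lact_linearr _)) -!lactM !tensM.
  by rewrite !mul1r !mulr1 opprB addrACA addrA subrK addrAC addrA addrNK subrr.
constructor; apply: (@BarComparison P u h1 (fun a b => d1^-1%VF (w1 a b))) => //.
- by move=> b c a a'; rewrite w1l linearP.
- by move=> a c b b'; rewrite w1r linearP.
Qed.

Definition cohomologous2 (c c' : L -> L -> L) : Prop :=
  exists g : 'End(L), forall a b,
    c a b - c' a b = a * g b - g (a * b) + g a * b.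

End Hochschild.

Section Conormal.
Variables (k : fieldType) (Q : quiver) (I : admissible_ideal k Q).

Local Notation L := (bound_quiver_algebra I).
Local Notation L2 := (bound_quiver_algebra (adm_square I)).

(* I/I^2, as the image of I in kQ/I^2 *)
Definition is_conormal (x : L2) : Prop :=
  exists2 a, I a & x = bqa_pi (adm_square I) a.

Fact conormal_submod : submod_prop is_conormal.
Proof.
have [I0 ID] := ideal_submod_prop (adm_ideal I).
split=> [|c x y [a Ia ->] [b Ib ->]]; first by exists 0; rewrite ?linear0.
by exists (c *: a + b); [apply: ID | rewrite linearP].
Qed.

Definition conormal : {vspace L2} := vspace_of conormal_submod.

Lemma mem_conormal x : x \in conormal <-> is_conormal x.
Proof. exact: mem_vspace_of. Qed.

(* I/I^2 as a kQ-bimodule *)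
Definition conormal_lact (a : path_alg k Q) (x : subvs_of conormal) :
    subvs_of conormal :=
  vsproj conormal (bqa_pi (adm_square I) a * vsval x).
Definition conormal_ract (x : subvs_of conormal) (a : path_alg k Q) :
    subvs_of conormal :=
  vsproj conormal (vsval x * bqa_pi (adm_square I) a).

Lemma conormal_lactE a x :
  vsval (conormal_lact a x) = bqa_pi (adm_square I) a * vsval x.
Proof.
rewrite vsprojK //; apply/mem_conormal.
have /mem_conormal[b Ib ->] := subvsP x; exists (a * b); last by rewrite rmorphM.
by have [_ _ /(_ a b Ib)[]] := adm_ideal I.
Qed.

Lemma conormal_ractE a x :
  vsval (conormal_ract x a) = vsval x * bqa_pi (adm_square I) a.
Proof.
rewrite vsprojK //; apply/mem_conormal.
have /mem_conormal[b Ib ->] := subvsP x; exists (b * a); last by rewrite rmorphM.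
by have [_ _ /(_ a b Ib)[]] := adm_ideal I.
Qed.

Fact conormal_lact_linearl x : linear (conormal_lact^~ x).
Proof.
move=> c a b; apply: val_inj; rewrite [LHS]conormal_lactE !linearP /=.
by rewrite !conormal_lactE mulrDl scalerAl.
Qed.
Fact conormal_lact_linearr a : linear (conormal_lact a).
Proof.
move=> c x y; apply: val_inj; rewrite [LHS]conormal_lactE !linearP /=.
by rewrite !conormal_lactE mulrDr scalerAr.
Qed.
Fact conormal_lact1 x : conormal_lact 1 x = x.
Proof. by apply: val_inj; rewrite [LHS]conormal_lactE rmorph1 mul1r. Qed.
Fact conormal_lactM a b x :
  conormal_lact (a * b) x = conormal_lact a (conormal_lact b x).
Proof.
by apply: val_inj; rewrite [LHS]conormal_lactE [RHS]conormal_lactE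
  conormal_lactE rmorphM mulrA.
Qed.
Fact conormal_ract_linearl a : linear (conormal_ract^~ a).
Proof.
move=> c x y; apply: val_inj; rewrite [LHS]conormal_ractE !linearP /=.
by rewrite !conormal_ractE mulrDl scalerAl.
Qed.
Fact conormal_ract_linearr x : linear (conormal_ract x).
Proof.
move=> c a b; apply: val_inj; rewrite [LHS]conormal_ractE !linearP /=.
by rewrite !conormal_ractE mulrDr scalerAr.
Qed.
Fact conormal_ract1 x : conormal_ract x 1 = x.
Proof. by apply: val_inj; rewrite [LHS]conormal_ractE rmorph1 mulr1. Qed.
Fact conormal_ractM x a b :
  conormal_ract x (a * b) = conormal_ract (conormal_ract x a) b.
Proof.
by apply: val_inj; rewrite [LHS]conormal_ractE [RHS]conormal_ractE
  conormal_ractE rmorphM mulrA.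
Qed.
Fact conormal_lract a x b :
  conormal_lact a (conormal_ract x b) = conormal_ract (conormal_lact a x) b.
Proof.
apply: val_inj; rewrite [LHS]conormal_lactE [RHS]conormal_ractE.
by rewrite conormal_ractE conormal_lactE mulrA.
Qed.

Definition conormal_bimod : bimodule (path_algebra k Q) :=
  @Bimodule k (path_algebra k Q)
    (LModule conormal_lact_linearl conormal_lact_linearr
       conormal_lact1 conormal_lactM)
    conormal_ract conormal_ract_linearl conormal_ract_linearr
    conormal_ract1 conormal_ractM conormal_lract.

Definition bqa_lact (a : path_alg k Q) (x : L) : L := bqa_pi I a * x.
Definition bqa_ract (x : L) (a : path_alg k Q) : L := x * bqa_pi I a.

Fact bqa_lact_linearl x : linear (bqa_lact^~ x).
Proof. by move=> c a b; rewrite /bqa_lact linearP mulrDl scalerAl. Qed.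
Fact bqa_lact_linearr a : linear (bqa_lact a).
Proof. by move=> c x y; rewrite /bqa_lact mulrDr scalerAr. Qed.
Fact bqa_lact1 x : bqa_lact 1 x = x.
Proof. by rewrite /bqa_lact rmorph1 mul1r. Qed.
Fact bqa_lactM a b x : bqa_lact (a * b) x = bqa_lact a (bqa_lact b x).
Proof. by rewrite /bqa_lact rmorphM mulrA. Qed.
Fact bqa_ract_linearl a : linear (bqa_ract^~ a).
Proof. by move=> c x y; rewrite /bqa_ract mulrDl scalerAl. Qed.
Fact bqa_ract_linearr x : linear (bqa_ract x).
Proof. by move=> c a b; rewrite /bqa_ract linearP mulrDr scalerAr. Qed.
Fact bqa_ract1 x : bqa_ract x 1 = x.
Proof. by rewrite /bqa_ract rmorph1 mulr1. Qed.
Fact bqa_ractM x a b : bqa_ract x (a * b) = bqa_ract (bqa_ract x a) b.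
Proof. by rewrite /bqa_ract rmorphM mulrA. Qed.
Fact bqa_lract a x b : bqa_lact a (bqa_ract x b) = bqa_ract (bqa_lact a x) b.
Proof. exact: mulrA. Qed.

Definition bqa_bimod : bimodule (path_algebra k Q) :=
  @Bimodule k (path_algebra k Q)
    (LModule bqa_lact_linearl bqa_lact_linearr bqa_lact1 bqa_lactM)
    bqa_ract bqa_ract_linearl bqa_ract_linearr
    bqa_ract1 bqa_ractM bqa_lract.

(* the canonical projection kQ/I^2 -> kQ/I, see [square_proj_pi] *)
Definition square_proj (x : L2) : L := bqa_pi I (bqa_repr x).

Lemma square_proj_pi a : square_proj (bqa_pi (adm_square I) a) = bqa_pi I a.
Proof.
apply/bqa_pi_eq; have [I0 ID IM] := adm_ideal I.
have [s hs ->] : ideal_mul I I (bqa_repr (bqa_pi (adm_square I) a) - a).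
  by apply/(@bqa_pi_eq k Q (adm_square I)); rewrite bqa_reprK.
elim: s hs => [|p s IHs] hs; first by rewrite big_nil.
rewrite big_cons; apply: ID.
  by have [_ Ip] := hs p (mem_head _ _); apply: (IM _ _ Ip).1.
by apply: IHs => q qs; apply: hs; rewrite inE qs orbT.
Qed.

Lemma square_section_exists : exists s : 'Hom(L, L2), cancel s square_proj.
Proof.
have pl : linear square_proj.
  move=> c x y; rewrite -[x]bqa_reprK -[y]bqa_reprK -linearP.
  by rewrite !square_proj_pi linearP.
pose m := GRing.isLinear.Build _ _ _ _ square_proj pl.
pose p : {linear L2 -> L} := HB.pack square_proj m.
exists ((linfun p)^-1)%VF => x; rewrite -[RHS](@limg_lfunVK _ _ _ (linfun p)).
  by rewrite lfunE.
apply/memv_imgP; exists (bqa_pi (adm_square I) (bqa_repr x)); first exact: memvf.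
by rewrite lfunE /= square_proj_pi bqa_reprK.
Qed.

(* The class of the cocycle [z] is the image of [f] under the canonical map
   from Hom(I/I^2, L) to HH^2(L), which sends [f] to the push-out along [f] of
   the square-zero extension 0 -> I/I^2 -> kQ/I^2 -> L -> 0, that is, to the
   Hochschild class of f(s(a) s(b) - s(ab)) for any linear section s.  Cocycles
   on [P] are compared with Hochschild cocycles through the bar resolution. *)
Definition canonical_class (P : proj_resolution (reg_bimod L))
    (z : subvs_of (cocycles P (reg_bimod L) 2))
    (f : BiHom conormal_bimod bqa_bimod) : Prop :=
  forall (h : bar_comparison P) (s : 'Hom(L, L2)), cancel s square_proj ->
    cohomologous2
      (fun a b => lfun_of (vsval z) (bc2 h a b))
      (fun a b => bifun_of f (vsproj conormal (s a * s b - s (a * b)))).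

End Conormal.

(* Main.v *)
From HB Require Import structures.
Require Import Defs.
From mathcomp Require Import ssrAC all_boot all_algebra all_field.
From mathcomp Require Import finmap boolp monalg.

Set Implicit Arguments.
Unset Strict Implicit.
Unset Printing Implicit Defensive.

Import GRing.Theory.
Local Open Scope ring_scope.

(** Write L = kQ/I and let E be the span of the vertices.  The bimodule L has a
    projective presentation T1 -> T0 -> L relative to E, where T0 is the sum over
    the vertices v of L e_v ⊗ e_v L and T1 is the sum over the arrows a of
    L e_s(a) ⊗ e_t(a) L.  Sending an arrow to its generator extends to a
    derivation Delta : kQ -> T1, and Delta identifies I/I^2 with the syzygy
    K = ker (T1 -> T0).  That Delta maps I onto K ([syzygy_form]) and that a
    bimodule map on I/I^2 can be read off from K ([syzygy_extension]) both come
    from a linear section s of kQ -> L: the element p ⊗ a ⊗ q of T1 differs from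
    an element depending only on its image in T0 by Delta of
    (s(p) a - s(p a)) q, which lies in I.

    Dimension shifting therefore presents HH^2(L) as Hom(I/I^2, L) modulo the
    bimodule maps that extend to T1, and it suffices that every bimodule map
    T1 -> L vanishes on K.  This is where the excess enters.  Let Q1 -> Q0 -> L
    be the minimal projective presentation that defines tau L.  The linear forms
    on the cokernel of Hom(Q0, L) -> Hom(Q1, L) embed into Hom(L, tau L)
    ([dim_tau_hom_ge]), while HH^1(L) is the subspace of that cokernel given by
    the maps that vanish on the kernel of Q1 -> Q0 ([dim_Ext1_le]).  Hence excess
    zero forces all maps Q1 -> L to vanish on that kernel
    ([excess0_kills_syzygy]).

    The property is carried over to T by comparison maps T -> Q -> T.  On K the
    composite is 1 + w with w : T1 -> T1 having image in K.  For g : T1 -> L, the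
    composite followed by g factors through Q1 and so vanishes on K, which means
    that g = - g w on K.  As I lies in the square of the arrow ideal, K
    consists of elements of T1 of positive length, so w raises the length
    filtration; that filtration is finite because I contains a power of the arrow
    ideal, and iterating gives g = 0 on K ([T_kills_syzygy]).

    For an arbitrary projective resolution P, a comparison map T -> P sends K into
    the image of P2 -> P1, and a 2-cocycle on P becomes a bimodule map on I/I^2
    ([restriction]).  Comparing bar cochains with Delta through a homotopy shows
    that this is inverse to the canonical map ([restriction_canonical]). *)

Local Notation "f $ x" := (lfun_of f x)
  (at level 10, x at level 9, left associativity).

(** * Projective presentations and their comparison maps *)

Arguments lact : simpl never.

Lemma lfun_exists (k : fieldType) (V W : vectType k) (f : V -> W) :
  linear f -> exists g : 'Hom(V, W), forall x, g x = f x.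
Proof.
move=> fl; pose m := GRing.isLinear.Build _ _ _ _ f fl.
pose g : {linear V -> W} := HB.pack f m.
by exists (linfun g) => x; rewrite lfunE.
Qed.

Section Presentations.
Variables (k : fieldType) (A : algType k).
Implicit Types X Y Z M N P : lmodule A.

Lemma lhom_exists X Y (f : X -> Y) :
  linear f -> (forall a x, f (lact a x) = lact a (f x)) ->
  exists g : LHom X Y, forall x, g $ x = f x.
Proof.
move=> fl fa; have [g gE] := lfun_exists fl.
exists (vsproj _ g) => x; rewrite lfun_ofK // => a y.
by rewrite !gE fa.
Qed.

Section Submodule.
Variables (M : lmodule A) (U : {vspace M}).
Hypothesis hU : forall a x, x \in U -> lact a x \in U.

Definition sub_lact (a : A) (x : subvs_of U) : subvs_of U :=
  vsproj U (lact a (vsval x)).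

Lemma sub_lactE a x : vsval (sub_lact a x) = lact a (vsval x).
Proof. by rewrite vsprojK // hU // subvsP. Qed.

Fact sub_lact_linearl x : linear (sub_lact^~ x).
Proof.
by move=> c a b; apply: val_inj; rewrite /= !(sub_lactE, linearP) lact_linearl.
Qed.
Fact sub_lact_linearr a : linear (sub_lact a).
Proof.
by move=> c x y; apply: val_inj; rewrite /= !(sub_lactE, linearP) lact_linearr.
Qed.
Fact sub_lact1 x : sub_lact 1 x = x.
Proof. by apply: val_inj; rewrite /= sub_lactE lact1. Qed.
Fact sub_lactM a b x : sub_lact (a * b) x = sub_lact a (sub_lact b x).
Proof. by apply: val_inj; rewrite /= !sub_lactE lactM. Qed.

Definition sub_lmodule : lmodule A :=
  LModule sub_lact_linearl sub_lact_linearr sub_lact1 sub_lactM.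
End Submodule.

Lemma limg_stable X Y (g : LHom X Y) a y :
  y \in limg (lfun_of g) -> lact a y \in limg (lfun_of g).
Proof. by move=> /memv_imgP[x _ ->]; rewrite -LHomP memv_img ?memvf. Qed.

(** Corestricting [g] to its image turns it into an epimorphism of modules, to
    which projectivity of [P] applies. *)
Lemma proj_lift P X Y (g : LHom X Y) (f : LHom P Y) : projective P ->
  (forall x, f $ x \in limg (lfun_of g)) ->
  exists h : LHom P X, forall x, g $ (h $ x) = f $ x.
Proof.
move=> pP fg; pose U := limg (lfun_of g).
have hU a y : y \in U -> lact a y \in U by exact: limg_stable.
pose S := sub_lmodule hU.
have lift Z (u : LHom Z Y) : (forall x, u $ x \in U) ->
    exists v : LHom Z S, forall x, vsval (v $ x : subvs_of U) = u $ x.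
  move=> uU; pose v x : S := vsproj U (u $ x).
  have vE x : vsval (v x) = u $ x by rewrite vsprojK.
  have vl : linear v by move=> c x y; rewrite /v !linearP.
  have va a x : v (lact a x) = lact a (v x).
    apply: val_inj; apply: etrans (vE _) _; rewrite LHomP.
    by apply/esym; apply: etrans (sub_lactE hU _ _) _; congr (lact a _); apply: vE.
  by have [w wE] := lhom_exists vl va; exists w => x; rewrite wE.
have [g' g'E] := lift X g (fun x => memv_img _ (memvf x)).
have [f' f'E] := lift P f fg.
have og : limg (lfun_of g') = fullv.
  apply/eqP; rewrite eqEsubv subvf /=; apply/subvP => y _.
  have /memv_imgP[x _ xE] : vsval (y : subvs_of U) \in U by exact: subvsP.
  by apply/memv_imgP; exists x; rewrite ?memvf //; apply: val_inj; rewrite /= g'E.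
have [h hE] := pP X S g' f' og; exists h => x.
by rewrite -f'E -hE comp_lfunE g'E.
Qed.

Lemma limg_fullP X Y (g : LHom X Y) :
  limg (lfun_of g) = fullv <-> forall y, exists x, g $ x = y.
Proof.
split=> [e y|h].
  have : y \in limg (lfun_of g) by rewrite e memvf.
  by move=> /memv_imgP[x _ ->]; exists x.
apply/eqP; rewrite eqEsubv subvf /=; apply/subvP => y _.
by have [x <-] := h y; rewrite memv_img ?memvf.
Qed.

(** A syzygy depends on the first two terms only, so that minimal presentations,
    full resolutions and the presentation over the vertices can be compared with
    one another. *)
Record ppres M := ProjPres {
  pp1 : lmodule A;
  pp0 : lmodule A;
  ppd : LHom pp1 pp0;
  ppe : LHom pp0 M;
  pp1_proj : projective pp1;
  pp0_proj : projective pp0;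
  ppe_onto : limg (lfun_of ppe) = fullv;
  pp_exact : limg (lfun_of ppd) = lker (lfun_of ppe) }.

Arguments pp1_proj {M} _ _ _ _ _ _.
Arguments pp0_proj {M} _ _ _ _ _ _.

Lemma ppeK M (X : ppres M) x : ppe X $ (ppd X $ x) = 0.
Proof. by apply/eqP; rewrite -memv_ker -pp_exact memv_img ?memvf. Qed.

Record ppmap M (X Y : ppres M) := PPMap {
  pm0 : LHom (pp0 X) (pp0 Y);
  pm1 : LHom (pp1 X) (pp1 Y);
  pm_aug : forall x, ppe Y $ (pm0 $ x) = ppe X $ x;
  pm_diff : forall x, ppd Y $ (pm1 $ x) = pm0 $ (ppd X $ x) }.

Lemma ppmap_exists M (X Y : ppres M) : inhabited (ppmap X Y).
Proof.
have ea0 x : ppe X $ x \in limg (lfun_of (ppe Y)) by rewrite ppe_onto memvf.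
have [a0 a0E] := proj_lift (pp0_proj X) ea0.
have ea x : precomp_fun (ppd X) a0 $ x \in limg (lfun_of (ppd Y)).
  by rewrite pp_exact memv_ker precomp_funE a0E ppeK.
have [a1 a1E] := proj_lift (pp1_proj X) ea.
by constructor; exists a0 a1 => // x; rewrite a1E precomp_funE.
Qed.

(** The composite is homotopic to the identity as far as the homotopy exists in
    this range: [w] is the error left in degree 1, where a presentation has no
    further term to absorb it. *)
Lemma ppmap_round_trip M (X Y : ppres M) (a : ppmap X Y) (b : ppmap Y X) :
  exists (s : LHom (pp0 X) (pp1 X)) (w : LHom (pp1 X) (pp1 X)),
    (forall x, ppd X $ (w $ x) = 0) /\
    forall x, pm1 b $ (pm1 a $ x) = x + s $ (ppd X $ x) + w $ x.
Proof.
have Hid (Z : lmodule A) (u : LHom Z Z) :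
    exists v : LHom Z Z, forall x, v $ x = u $ x - x.
  apply: lhom_exists => [c x y|c x].
    by rewrite linearP scalerBr opprD addrACA.
  by rewrite LHomP -(linB (lact_linearr c)).
have [v0 v0E] := Hid _ (precomp_fun (pm0 a) (pm0 b)).
have [v1 v1E] := Hid _ (precomp_fun (pm1 a) (pm1 b)).
have v0im x : v0 $ x \in limg (lfun_of (ppd X)).
  by rewrite pp_exact memv_ker v0E linearB /= precomp_funE !pm_aug subrr.
have [s sE] := proj_lift (pp0_proj X) v0im.
have [w wE] : exists w : LHom (pp1 X) (pp1 X),
    forall x, w $ x = v1 $ x - s $ (ppd X $ x).
  apply: lhom_exists => [c x y|c x]; last by rewrite !LHomP -(linB (lact_linearr c)).
  by rewrite !linearP /= addrACA -scalerDr.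
exists s, w; split=> x; last first.
  by rewrite wE v1E precomp_funE -[_ - _ - _]addrA -opprD [RHS]addrC subrK.
rewrite wE v1E !linearB /= precomp_funE sE v0E precomp_funE !pm_diff.
by rewrite subrr.
Qed.

End Presentations.

(** * Modules generated by idempotents, and dual bases *)

Section IdempotentModules.
Variables (k : fieldType) (A : falgType k) (J : finType) (rho : J -> A).

Definition ffun_lact (a : A) (f : {ffun J -> A}) : {ffun J -> A} :=
  [ffun j => a * f j].

Fact ffun_lact_linearl f : linear (ffun_lact^~ f).
Proof. by move=> c a b; apply/ffunP => j; rewrite !ffunE mulrDl scalerAl. Qed.
Fact ffun_lact_linearr a : linear (ffun_lact a).
Proof. by move=> c f g; apply/ffunP => j; rewrite !ffunE mulrDr scalerAr. Qed.
Fact ffun_lact1 f : ffun_lact 1 f = f.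
Proof. by apply/ffunP => j; rewrite ffunE mul1r. Qed.
Fact ffun_lactM a b f : ffun_lact (a * b) f = ffun_lact a (ffun_lact b f).
Proof. by apply/ffunP => j; rewrite !ffunE mulrA. Qed.

Definition ffun_lmodule : lmodule A :=
  LModule ffun_lact_linearl ffun_lact_linearr ffun_lact1 ffun_lactM.

Fact idem_submod :
  submod_prop (fun f : ffun_lmodule =>
    forall j, (f : {ffun _ -> _}) j * rho j = (f : {ffun _ -> _}) j).
Proof.
split=> [j|c f g hf hg j]; first by rewrite ffunE mul0r.
by rewrite !ffunE mulrDl -scalerAl hf hg.
Qed.

Fact idem_stable (a : A) (f : ffun_lmodule) :
  f \in vspace_of idem_submod -> lact a f \in vspace_of idem_submod.
Proof.
move=> /mem_vspace_of hf; apply/mem_vspace_of => j.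
by rewrite /= ffunE -mulrA hf.
Qed.

(** The direct sum of the left ideals [A * rho j], with its coordinate functions;
    it is realized as the module of families [f] with [f j * rho j = f j]. *)
Lemma idem_exists : exists T : {X : lmodule A & X -> J -> A},
  [/\ forall j, linear (projT2 T ^~ j),
      forall a t j, projT2 T (lact a t) j = a * projT2 T t j,
      forall t j, projT2 T t j * rho j = projT2 T t j,
      forall s t, projT2 T s =1 projT2 T t -> s = t &
      forall f : J -> A, (forall j, f j * rho j = f j) ->
        exists t, projT2 T t =1 f].
Proof.
pose U := vspace_of idem_submod.
exists (existT (fun X : lmodule A => X -> J -> A) (sub_lmodule idem_stable)
  (fun (t : subvs_of U) j => (vsval t : {ffun J -> A}) j)); split=> /=.
- by move=> j c s t; rewrite linearP !ffunE.
- by move=> a t j; rewrite (sub_lactE idem_stable) ffunE.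
- by move=> t; apply: (proj1 (mem_vspace_of idem_submod _) (subvsP t)).
- by move=> s t e; apply: val_inj; apply/ffunP.
move=> f hf; exists (vsproj U [ffun j => f j]) => j; rewrite vsprojK ?ffunE //.
by apply/mem_vspace_of => i; rewrite !ffunE.
Qed.

Definition idem_lmodule : lmodule A := projT1 (sval (cid idem_exists)).
Definition icoef : idem_lmodule -> J -> A := projT2 (sval (cid idem_exists)).

Lemma icoef_linear j : linear (icoef^~ j).
Proof. by have [h _ _ _ _] := svalP (cid idem_exists); apply: h. Qed.

Lemma icoef_lact a t j : icoef (lact a t) j = a * icoef t j.
Proof. by have [_ h _ _ _] := svalP (cid idem_exists); apply: h. Qed.

Lemma icoef_rho t j : icoef t j * rho j = icoef t j.
Proof. by have [_ _ h _ _] := svalP (cid idem_exists); apply: h. Qed.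

Lemma icoef_eq s t : icoef s =1 icoef t -> s = t.
Proof. by have [_ _ _ h _] := svalP (cid idem_exists); apply: h. Qed.

Lemma icoef_exists (f : J -> A) :
  (forall j, f j * rho j = f j) -> exists t, icoef t =1 f.
Proof. by have [_ _ _ _ h] := svalP (cid idem_exists); apply: h. Qed.

Lemma idem_lhom X (x : J -> lmod_vect X) : exists h : LHom idem_lmodule X,
  forall t, h $ t = \sum_j lact (icoef t j) (x j).
Proof.
apply: lhom_exists => [c s t|a t].
  rewrite scaler_sumr -big_split; apply: eq_bigr => j _ /=.
  by rewrite icoef_linear lact_linearl.
rewrite (lin_sum (lact_linearr a)); apply: eq_bigr => j _.
by rewrite icoef_lact lactM.
Qed.

Hypothesis rho_idem : forall j, rho j * rho j = rho j.

Lemma igen_subproof j : exists t : idem_lmodule,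
  forall i, icoef t i = if i == j then rho j else 0.
Proof.
have [|t tE] := @icoef_exists (fun i => if i == j then rho j else 0).
  by move=> i; case: eqP => [->|_]; rewrite ?rho_idem ?mul0r.
by exists t.
Qed.

Definition igen j : idem_lmodule := sval (cid (igen_subproof j)).

Lemma icoef_gen j i : icoef (igen j) i = if i == j then rho j else 0.
Proof. exact: (svalP (cid (igen_subproof j))). Qed.

Lemma sum_igen X (x : J -> lmod_vect X) j :
  \sum_i lact (icoef (igen j) i) (x i) = lact (rho j) (x j).
Proof.
rewrite (bigD1 j) //= big1 => [|i /negPf ni]; rewrite icoef_gen ?eqxx ?addr0 //.
by rewrite ni (lin0 (lact_linearl _)).
Qed.

Lemma lact_igen j : lact (rho j) (igen j) = igen j.
Proof.
apply: icoef_eq => i; rewrite icoef_lact icoef_gen.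
by case: eqP => _; rewrite ?rho_idem ?mulr0.
Qed.

Lemma igen_sumE t : t = \sum_j lact (icoef t j) (igen j).
Proof.
apply: icoef_eq => i; rewrite (lin_sum (icoef_linear i)) (bigD1 i) //=.
rewrite big1 => [|j /negPf nj]; rewrite icoef_lact icoef_gen.
  by rewrite eqxx icoef_rho addr0.
by rewrite eq_sym nj mulr0.
Qed.

Lemma idem_projective : projective idem_lmodule.
Proof.
move=> X Y g f /limg_fullP og.
pose x j := sval (cid (og (f $ (igen j)))).
have xE j : g $ (x j) = f $ (igen j) by exact: (svalP (cid (og _))).
have [h hE] := idem_lhom x; exists h; apply/lfunP => t.
rewrite comp_lfunE hE linear_sum {2}[t]igen_sumE linear_sum.
by apply: eq_bigr => j _; rewrite [LHS]/= [RHS]/= (LHomP g) (LHomP f) xE.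
Qed.

End IdempotentModules.

Section DualBasis.
Variables (k : fieldType) (A : falgType k) (P : lmodule A).

(** [P] is a direct summand of a free module of finite rank; the [q j] are the
    coordinates of a splitting. *)
Lemma dual_basis : projective P ->
  exists (J : finType) (q : J -> LHom P (reg_lmodule A)) (x : J -> P),
    forall y, y = \sum_j lact (q j $ y) (x j).
Proof.
move=> pP; pose J := 'I_(\dim {:P}); pose rho (j : J) : A := 1.
pose x (j : J) : P := (vbasis {:P})`_j.
have [h hE] := idem_lhom rho x.
have idP : exists i : LHom P P, forall y, i $ y = y by exact: lhom_exists.
have [i iE] := idP.
have rho_idem j : rho j * rho j = rho j by rewrite mulr1.
have og y : i $ y \in limg (lfun_of h).
  rewrite iE (coord_vbasis (memvf y)) memv_suml // => j _.
  rewrite memvZ //; apply/memv_imgP; exists (igen rho_idem j); first exact: memvf.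
  by rewrite hE sum_igen lact1.
have [q qE] := proj_lift pP og.
have qjE (j : J) : exists r : LHom P (reg_lmodule A),
    forall y, r $ y = icoef (q $ y) j.
  apply: lhom_exists => [c y z|a y]; first by rewrite linearP icoef_linear.
  by rewrite LHomP icoef_lact.
exists J, (fun j => sval (cid (qjE j))), x => y.
rewrite -[LHS]iE -qE hE; apply: eq_bigr => j _; congr (lact _ _).
exact/esym/(svalP (cid (qjE j))).
Qed.

End DualBasis.

(** * A bound for the maps into the Auslander-Reiten translate *)

Section Dimensions.
Variable k : fieldType.

Lemma dim_vquot (V : vectType k) (U : {vspace V}) :
  (\dim U + \dim {: vquot U})%N = \dim {: V}.
Proof.
pose p := linfun (vquot_pi U).
have pE x : p x = vquot_pi U x by rewrite lfunE.
have kerp : lker p = U.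
  apply/vspaceP => x; rewrite memv_ker pE.
  by apply/eqP/idP => [/lquot_pi0|xU] //; apply/lquot_pi0.
have imp : limg p = fullv.
  apply/eqP; rewrite eqEsubv subvf /=; apply/subvP => y _.
  by rewrite -[y]vquot_reprK -pE memv_img ?memvf.
by rewrite -(limg_ker_dim p fullv) capfv kerp imp.
Qed.

Lemma dim_dual (V : vectType k) : \dim {: 'Hom(V, k^o)} = \dim {: V}.
Proof. by rewrite !dimvf /dim /= muln1. Qed.

Lemma leq_dim_inj (V W : vectType k) (f : V -> W) :
  linear f -> (forall x, f x = 0 -> x = 0) -> (\dim {:V} <= \dim {:W})%N.
Proof.
move=> fl fi; have [g gE] := lfun_exists fl.
rewrite -(limg_ker_dim g fullv) capfv (_ : lker g = 0%VS) ?dimv0.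
  exact/dimvS/subvf.
apply/eqP; rewrite -subv0; apply/subvP => x; rewrite memv_ker gE memv0.
by move=> /eqP/fi->.
Qed.

Lemma leq_dim_ker (V W : vectType k) (f : V -> W) (Z U : {vspace V}) :
  linear f -> (forall y, exists2 x, x \in Z & f x = y) ->
  (forall x, x \in U -> x \in Z /\ f x = 0) ->
  (\dim U + \dim {:W} <= \dim Z)%N.
Proof.
move=> fl fs fU; have [g gE] := lfun_exists fl.
rewrite -(limg_ker_dim g Z) leq_add ?dimvS //.
  by apply/subvP => x /fU[xZ f0]; rewrite memv_cap memv_ker gE xZ f0 eqxx.
by apply/subvP => y _; have [x xZ <-] := fs y; rewrite -gE memv_img.
Qed.
End Dimensions.

Section AuslanderReitenBound.
Variables (k : fieldType) (A : falgType k) (M : lmodule A).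
Variable pres : min_proj_pres M.

Local Notation Q1 := (pres1 pres).
Local Notation W := (limg (precomp M (pres_d1 pres))).
Local Notation U := (limg (transpose_map pres)).

Lemma rank1_exists (X : lmodule A) (q : LHom X (reg_lmodule A)) (m : M) :
  exists f : LHom X M, forall x, f $ x = lact (q $ x : A) m.
Proof.
apply: lhom_exists => [c x y|a x]; first by rewrite linearP lact_linearl.
by rewrite LHomP -lactM.
Qed.

(** The image of [q ⊗ m] under the canonical map from Hom_A(X, A) ⊗ M to
    Hom_A(X, M). *)
Definition rank1 X (q : LHom X (reg_lmodule A)) m : LHom X M :=
  sval (cid (rank1_exists q m)).

Lemma rank1E X (q : LHom X (reg_lmodule A)) m x :
  rank1 q m $ x = lact (q $ x : A) m.
Proof. exact: (svalP (cid (rank1_exists q m))). Qed.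

Lemma rank1_linearl X m : linear (fun q : LHom X _ => rank1 q m).
Proof.
move=> c p q; apply: LHom_eq => x; rewrite lfun_of_lin !rank1E.
by rewrite lfun_of_lin lact_linearl.
Qed.

Lemma rank1_linearr X (q : LHom X _) : linear (rank1 q).
Proof.
by move=> c m n; apply: LHom_eq => x; rewrite lfun_of_lin !rank1E lact_linearr.
Qed.

Lemma rank1_star X (q : LHom X _) a m : rank1 (star_act q a) m = rank1 q (lact a m).
Proof. by apply: LHom_eq => x; rewrite !rank1E star_actE lactM. Qed.

Lemma rank1_precomp q m : rank1 (transpose_map pres q) m \in W.
Proof.
apply/memv_imgP; exists (rank1 q m); first exact: memvf.
by apply: LHom_eq => x; rewrite precompE !rank1E precompE.
Qed.

(** A linear form on the cokernel of Hom(Q0, M) -> Hom(Q1, M) composed with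
    [rank1] is a balanced form on Tr M x M, and hence a morphism from M to
    D Tr M. *)
Lemma tau_hom_exists (l : 'Hom(vquot W, k^o)) :
  exists g : LHom M (tau pres), forall m q,
    (g $ m : 'Hom(vquot U, k^o)) (vquot_pi U q) = l (vquot_pi W (rank1 q m)).
Proof.
pose F m (y : vquot U) : k^o := l (vquot_pi W (rank1 (vquot_repr y) m)).
have FE m q : F m (vquot_pi U q) = l (vquot_pi W (rank1 q m)).
  congr (l _); apply/vquot_pi_eq; rewrite -(linB (rank1_linearl m)).
  have /memv_imgP[p _ ->] : vquot_repr (vquot_pi U q) - q \in U.
    by apply/vquot_pi_eq; rewrite vquot_reprK.
  exact: rank1_precomp.
have Fl m : linear (F m).
  move=> c x y; rewrite -[x]vquot_reprK -[y]vquot_reprK -linearP !FE.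
  by rewrite rank1_linearl !linearP.
pose f m : tau pres := sval (cid (lfun_exists (Fl m))).
have fE m q : (f m : 'Hom(vquot U, k^o)) (vquot_pi U q) = l (vquot_pi W (rank1 q m)).
  by rewrite (svalP (cid (lfun_exists (Fl m)))) FE.
have ext (s t : tau pres) : (forall q, (s : 'Hom(vquot U, k^o)) (vquot_pi U q) =
     (t : 'Hom(vquot U, k^o)) (vquot_pi U q)) -> s = t.
  by move=> e; apply/lfunP => y; rewrite -[y]vquot_reprK e.
have [g gE] : exists g : LHom M (tau pres), forall m, g $ m = f m.
  apply: lhom_exists => [c m n|a m]; apply: ext => q.
    by rewrite add_lfunE scale_lfunE !fE rank1_linearr !linearP.
  rewrite fE -rank1_star -fE; apply/esym.
  apply: etrans (comp_lfunE _ (@ract_lfun _ _ (Tr pres) a) _) _.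
  rewrite ract_lfunE; congr (fun_of_lfun (f m) _).
  exact: (rquot_act_pi (@transpose_stable _ _ _ pres)).
by exists g => m q; rewrite gE fE.
Qed.

(** The assignment of [tau_hom_exists] is injective: as [Q1] is projective, it has
    a dual basis, so the maps [rank1 q m] span Hom(Q1, M). *)
Lemma dim_tau_hom_ge :
  (\dim {: LHom Q1 M} <= \dim W + \dim {: LHom M (tau pres)})%N.
Proof.
pose G l := sval (cid (tau_hom_exists l)).
have GE l m q : (G l $ m : 'Hom(vquot U, k^o)) (vquot_pi U q) =
    l (vquot_pi W (rank1 q m)) by exact: (svalP (cid (tau_hom_exists l))).
rewrite -(dim_vquot W) leq_add2l -dim_dual; apply: (@leq_dim_inj _ _ _ G).
  move=> c l l'; apply: LHom_eq => m; apply/lfunP => y; rewrite -[y]vquot_reprK.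
  by rewrite lfun_of_lin add_lfunE scale_lfunE !GE add_lfunE scale_lfunE.
move=> l Gl0; apply/lfunP => y; rewrite -[y]vquot_reprK zero_lfunE.
have [J [q [x qx]]] := dual_basis (@pres1_proj _ _ _ pres).
have -> : vquot_repr y = \sum_j rank1 (q j) (vquot_repr y $ (x j)).
  apply: LHom_eq => z; rewrite {1}[z](qx z) linear_sum /lfun_of linear_sum.
  rewrite sum_lfunE; apply: eq_bigr => j _.
  by rewrite -[vsval]/(@lfun_of _ _ _ _) rank1E; apply: LHomP.
rewrite !linear_sum big1 // => j _; rewrite /= -GE Gl0.
by rewrite /lfun_of linear0 !zero_lfunE.
Qed.
End AuslanderReitenBound.

(** * First extensions and the meaning of excess zero *)

Section FirstExt.
Variables (k : fieldType) (A : algType k) (M : lmodule A).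
Implicit Types Y Z : lmodule A.

Definition res_ppres (P : proj_resolution M) : ppres M :=
  ProjPres (@res_proj _ _ _ P 1) (@res_proj _ _ _ P 0) (res_aug_onto P)
    (res_exact0 P).

Definition min_ppres (pres : min_proj_pres M) : ppres M :=
  ProjPres (@pres1_proj _ _ _ pres) (@pres0_proj _ _ _ pres)
    (proj1 (pres0_cover pres)) (proj1 (pres1_cover pres)).

Variables (X : ppres M) (P : proj_resolution M) (N : lmodule A).

Lemma lfun_ofB Y Z (f g : LHom Y Z) (x : Y) : (f - g) $ x = f $ x - g $ x.
Proof. by rewrite /lfun_of linearB add_lfunE opp_lfunE. Qed.

Lemma lfun_of0 Y Z (x : Y) : (0 : LHom Y Z) $ x = 0.
Proof. by rewrite /lfun_of linear0 zero_lfunE. Qed.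

(** These maps are the ones that induce a map on the image of [ppd X], the kernel
    of [ppe X]. *)
Fact kills_syzygy_submod : submod_prop (fun f : LHom (pp1 X) N =>
  forall x, ppd X $ x = 0 -> f $ x = 0).
Proof.
split=> [x _|c f g hf hg x x0]; first by rewrite lfun_of0.
by rewrite lfun_of_lin hf // hg // scaler0 addr0.
Qed.
Definition kills_syzygy := vspace_of kills_syzygy_submod.

Lemma kills_syzygyP f :
  f \in kills_syzygy <-> forall x, ppd X $ x = 0 -> f $ x = 0.
Proof. exact: mem_vspace_of. Qed.

Lemma Ext_class0 n (z : subvs_of (cocycles P N n.+1)) :
  Ext_class z = 0 <-> exists y : cochain P N n, vsval z = codiff P N n y.
Proof.
apply: iff_trans (@lquot_pi0 _ _ _ _ _) _; rewrite -memv_preim lfunE.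
split=> [/memv_imgP[y _ e]|[y e]]; first by exists y.
by apply/memv_imgP; exists y; first exact: memvf.
Qed.

Lemma Ext_class_linear n : linear (@Ext_class _ _ _ P N n).
Proof. by move=> c z z'; rewrite /Ext_class linearP. Qed.

Lemma cocycleP n (z : cochain P N n) :
  z \in cocycles P N n <-> forall x, z $ (res_d P n $ x) = 0.
Proof.
rewrite memv_ker; split=> [/eqP z0 x|h].
  by rewrite -precompE [X in X $ _]z0 lfun_of0.
apply/eqP/LHom_eq => x; rewrite precompE h.
by rewrite lfun_of0.
Qed.

(** Pulling back along a comparison map [P -> X] sends the maps that kill the
    syzygy onto Ext^1, by homotopy invariance, and sends the maps that extend to
    [pp0 X] to zero. *)
Lemma dim_Ext1_le :
  (\dim (limg (precomp N (ppd X))) + \dim {: Ext P N 1} <= \dim kills_syzygy)%N.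
Proof.
have [a] := ppmap_exists X (res_ppres P).
have [b] := ppmap_exists (res_ppres P) X.
pose F (f : LHom (pp1 X) N) : cochain P N 1 := precomp N (pm1 b) f.
have FE f x : F f $ x = f $ (pm1 b $ x) by exact: precompE.
pose G f := Ext_class (vsproj (cocycles P N 1) (F f)).
have Gl : linear G by move=> c f g; rewrite /G /F !linearP Ext_class_linear.
have d01 x : res_d P 0 $ (res_d P 1 $ x) = 0.
  by apply/eqP; rewrite -memv_ker -res_exact memv_img ?memvf.
have FZ f : f \in kills_syzygy -> F f \in cocycles P N 1.
  move=> /kills_syzygyP fZ; apply/cocycleP => x.
  by rewrite FE fZ // pm_diff [ppd _ $ _]d01 linear0.
apply: (leq_dim_ker Gl) => [y|f /memv_imgP[g _ fE]].
  pose z := vquot_repr y; pose f : LHom (pp1 X) N := precomp N (pm1 a) (vsval z).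
  have z0 (x : res_obj P 1) : res_d P 0 $ x = 0 -> lfun_of (vsval z) x = 0.
    move=> x0; have : x \in limg (lfun_of (res_d P 1)).
      by rewrite res_exact memv_ker x0.
    by move=> /memv_imgP[u _ ->]; exact: (proj1 (cocycleP _) (subvsP z)).
  have fZ : f \in kills_syzygy.
    apply/kills_syzygyP => x x0; rewrite precompE z0 //.
    by have := pm_diff a x; rewrite x0 linear0 => ->.
  exists f => //; rewrite -[y]vquot_reprK; apply/eqP.
  rewrite -subr_eq0 -[vquot_pi _ _]/(Ext_class z) /G -(linB (@Ext_class_linear 1)).
  apply/eqP/Ext_class0.
  have [s [w [w0 abE]]] := ppmap_round_trip b a.
  exists (precomp_fun s (vsval z)); apply: LHom_eq => x.
  rewrite (linearB vsval) /= vsprojK ?FZ // precompE precomp_funE lfun_ofB.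
  rewrite FE precompE abE !linearD /= (z0 _ (w0 x)) addr0.
  by rewrite addrC addKr.
have fZ : f \in kills_syzygy.
  by apply/kills_syzygyP => x x0; rewrite fE precompE x0 linear0.
split=> //; apply/Ext_class0; exists (precomp_fun (pm0 b) g).
apply: LHom_eq => x; rewrite vsprojK ?FZ // FE fE !precompE precomp_funE.
by rewrite pm_diff.
Qed.

End FirstExt.

Section ZeroExcess.
Variables (k : fieldType) (L : falgType k).
Variables (pres : min_proj_pres (reg_bimod L)) (P : proj_resolution (reg_bimod L)).

(** With V = Hom(Q1, L) for the presentation Q1 -> Q0 -> L, W the image of
    Hom(Q0, L) and Z the maps in V that kill
    the syzygy, [dim_tau_hom_ge] and [dim_Ext1_le] read
    dim V - dim W <= dim HH1tau = dim HH1 <= dim Z - dim W, so Z = V. *)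
Lemma excess0_kills_syzygy : excess pres P = 0 ->
  forall (f : LHom (pres1 pres) (reg_bimod L)) x, pres_d1 pres $ x = 0 -> f $ x = 0.
Proof.
move=> /eqP; rewrite subr_eq0 => /eqP[]; rewrite dim_dual => e f.
apply/(@kills_syzygyP _ _ _ (min_ppres pres)).
suff /eqP-> : kills_syzygy (min_ppres pres) (reg_bimod L) == fullv by exact: memvf.
rewrite eqEdim subvf (leq_trans (dim_tau_hom_ge pres)) // e.
exact: (dim_Ext1_le (min_ppres pres)).
Qed.
End ZeroExcess.

(** * Bimodules and derivations of a path algebra *)

HB.lock Definition lmul (k : fieldType) (L : falgType k)
  (X : lmodule (env_alg L)) (a : L) (x : X) : X := lact (tens a 1 : env_alg L) x.
HB.lock Definition rmul (k : fieldType) (L : falgType k)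
  (X : lmodule (env_alg L)) (x : X) (b : L) : X := lact (tens 1 b : env_alg L) x.
Arguments lmul {k L X} a x.
Arguments rmul {k L X} x b.

Section BimoduleActions.
Variables (k : fieldType) (L : falgType k).
Implicit Types X Y : lmodule (env_alg L).
Implicit Types a b : L.

Lemma lmul_linearl X (x : X) : linear (lmul^~ x : L -> X).
Proof. by move=> c a b; rewrite lmul.unlock tens_linl lact_linearl. Qed.
Lemma lmul_linearr X a : linear (lmul a : X -> X).
Proof. by move=> c x y; rewrite ?lmul.unlock ?rmul.unlock lact_linearr. Qed.
Lemma rmul_linearl X b : linear (rmul^~ b : X -> X).
Proof. by move=> c x y; rewrite ?lmul.unlock ?rmul.unlock lact_linearr. Qed.
Lemma rmul_linearr X (x : X) : linear (rmul x).
Proof. by move=> c a b; rewrite rmul.unlock tens_linr lact_linearl. Qed.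

Lemma lmul1 X (x : X) : lmul 1 x = x.
Proof. by rewrite lmul.unlock tens1 lact1. Qed.
Lemma rmul1 X (x : X) : rmul x 1 = x.
Proof. by rewrite rmul.unlock tens1 lact1. Qed.
Lemma lmulM X a b (x : X) : lmul (a * b) x = lmul a (lmul b x).
Proof. by rewrite lmul.unlock -lactM tensM mulr1. Qed.
Lemma rmulM X (x : X) a b : rmul x (a * b) = rmul (rmul x a) b.
Proof. by rewrite rmul.unlock -lactM tensM mulr1. Qed.
Lemma lmul_rmul X a (x : X) b : lmul a (rmul x b) = rmul (lmul a x) b.
Proof. by rewrite lmul.unlock rmul.unlock -!lactM !tensM !mulr1 !mul1r. Qed.
Lemma lact_tens X a b (x : X) :
  lact (tens a b : env_alg L) x = lmul a (rmul x b).
Proof. by rewrite lmul.unlock rmul.unlock -lactM tensM !mulr1. Qed.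

Lemma LHom_lmul X Y (f : LHom X Y) a x : f $ (lmul a x) = lmul a (f $ x).
Proof. by rewrite ?lmul.unlock ?rmul.unlock LHomP. Qed.
Lemma LHom_rmul X Y (f : LHom X Y) x b : f $ (rmul x b) = rmul (f $ x) b.
Proof. by rewrite ?lmul.unlock ?rmul.unlock LHomP. Qed.

Lemma reg_lmul a (x : reg_bimod L) : lmul a x = a * x.
Proof. by rewrite lmul.unlock; apply: etrans (biact_tens _ _ _) _; rewrite mulr1. Qed.
Lemma reg_rmul (x : reg_bimod L) b : rmul x b = (x : L) * b.
Proof.
by rewrite rmul.unlock; apply: etrans (biact_tens _ _ _) _; congr (_ * _); exact: mul1r.
Qed.

Lemma bilhom_exists X Y (f : X -> Y) : linear f ->
  (forall a x, f (lmul a x) = lmul a (f x)) ->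
  (forall x b, f (rmul x b) = rmul (f x) b) ->
  exists g : LHom X Y, forall x, g $ x = f x.
Proof.
move=> fl fL fR; apply: lhom_exists => // M x.
elim/env_ind: M => [|c M N IHM IHN|a b].
- by rewrite !(lin0 (lact_linearl _)) (lin0 fl).
- by rewrite !lact_linearl fl IHM IHN.
by rewrite !lact_tens fL fR.
Qed.

(** The linear map on the tensor square of [L] induced by a bilinear map [h]. *)
Definition tens_lift (V : lmodType k) (h : L -> L -> V) (M : env L) : V :=
  \sum_i \sum_j M i j *: h (vbasis {:L})`_i (vbasis {:L})`_j.

Lemma tens_lift_linear (V : lmodType k) (h : L -> L -> V) : linear (tens_lift h).
Proof.
move=> c M N; rewrite /tens_lift.
do 2![rewrite ?scaler_sumr -?big_split; apply: eq_bigr => ? _ /=].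
by rewrite !mxE scalerDl scalerA.
Qed.

Lemma tens_liftE (V : lmodType k) (h : L -> L -> V) a b :
  (forall b, linear (h^~ b)) -> (forall a, linear (h a)) ->
  tens_lift h (tens a b) = h a b.
Proof.
move=> hl hr; have hZ c u v : h (c *: u) v = c *: h u v := linZ (hl v) c u.
rewrite {2}[a]vbasis_coordE (lin_sum (hl b)); apply: eq_bigr => i _.
rewrite hZ {2}[b]vbasis_coordE (lin_sum (hr _)) scaler_sumr.
by apply: eq_bigr => j _; rewrite (linZ (hr _)) mxE scalerA.
Qed.

End BimoduleActions.

Section PathDerivation.
Variables (k : fieldType) (Q : quiver) (I : admissible_ideal k Q).
Local Notation L := (bound_quiver_algebra I).
Local Notation B := (path_alg k Q).
Local Notation pi := (bqa_pi I : B -> L).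
Local Notation pv v := (pbasis k (@vpath Q v)).
Local Notation pa a := (pbasis k (@apath Q a)).

Definition videm (v : vertex Q) : L := pi (pv v).
Definition arr (a : arrow Q) : L := pi (pa a).

Lemma videmM v w : videm v * videm w = if v == w then videm v else 0.
Proof.
rewrite /videm -rmorphM path_mulE /pmul pcat_vl /psource /=.
by case: eqP => [->|_] //=; rewrite linear0.
Qed.

Lemma videm_sum : \sum_v videm v = 1.
Proof. by rewrite /videm -linear_sum -[RHS](rmorph1 (bqa_pi I)). Qed.

Lemma pathM_l (p : qpath Q) v :
  videm v * pi (pbasis k p) = if v == psource p then pi (pbasis k p) else 0.
Proof.
rewrite /videm -rmorphM path_mulE /pmul pcat_vl.
by case: eqP => _ //=; rewrite linear0.
Qed.

Lemma pathM_r (p : qpath Q) v :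
  pi (pbasis k p) * videm v = if v == ptarget p then pi (pbasis k p) else 0.
Proof.
rewrite /videm -rmorphM path_mulE /pmul pcat_vr.
by case: eqP => _ //=; rewrite linear0.
Qed.

Definition word (s : seq (arrow Q)) : L := \prod_(a <- s) arr a.

Lemma pbasis_cons a v s (h : walk v (a :: s)) (h' : walk (target a) s) :
  pbasis k (@QPath Q (v, a :: s) h) = pa a * pbasis k (@QPath Q (target a, s) h').
Proof.
rewrite path_mulE /pmul; have /= /andP[/eqP sa _] := h.
case: pcatP => [r _ e1 e2 _|] //=.
by congr pbasis; apply: qpath_inj; rewrite ?e1 ?e2 /psource /=.
Qed.

Lemma path_word_ind (S : B -> Prop) : submod_prop S ->
  (forall v, S (pv v)) -> (forall a y, S y -> S (pa a * y)) -> forall y, S y.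
Proof.
move=> [S0 SD] Sv Sa; apply: path_alg_ind => // -[[v s] h].
elim: s v h => [|a s IHs] v h.
  by rewrite (_ : QPath h = vpath v) //; apply: qpath_inj.
have /= /andP[_ wk] := h.
by rewrite (pbasis_cons h wk); apply: Sa (IHs _ wk).
Qed.

Lemma path_word p : pi (pbasis k p) = videm (psource p) * word (parrows p).
Proof.
case: p => [[v s] h]; rewrite /psource /parrows /=; elim: s v h => [|a s IHs] v h.
  by rewrite /word big_nil mulr1; congr (pi (pbasis _ _)); apply: qpath_inj.
have /= /andP[/eqP sa wk] := h.
rewrite (pbasis_cons h wk) rmorphM /= (IHs _ wk) /word big_cons -/(word s) -sa.
rewrite -[_ (pa a)]/(arr a) [LHS]mulrA [RHS]mulrA; congr (_ * _).
by rewrite /arr pathM_l pathM_r !eqxx.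
Qed.

Variables (X : lmodule (env_alg L)) (x : arrow Q -> X).
Hypothesis xl : forall a, lmul (videm (source a)) (x a) = x a.
Hypothesis xr : forall a, rmul (x a) (videm (target a)) = x a.

(** The value at a path with arrows [s] of the derivation with value [x a] at each
    arrow [a].  The coefficients are bare words of arrows: the idempotents at the
    ends of a path can be left out because the [x a] absorb them. *)
Fixpoint wder (s : seq (arrow Q)) : X :=
  if s is a :: s' then rmul (x a) (word s') + lmul (arr a) (wder s') else 0.

Lemma wder_cat s t : wder (s ++ t) = rmul (wder s) (word t) + lmul (word s) (wder t).
Proof.
elim: s => [|a s IHs] /=.
  by rewrite /word big_nil lmul1 (lin0 (rmul_linearl _)) add0r.
rewrite IHs (linD (rmul_linearl _)) (linD (lmul_linearr _)) /word big_cat big_cons /=.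
by rewrite rmulM lmulM lmul_rmul addrA.
Qed.

Lemma wder_source (p : qpath Q) v :
  lmul (videm v) (wder (parrows p)) = if v == psource p then wder (parrows p) else 0.
Proof.
case: p => [[u [|a s]] h]; rewrite /psource /parrows /=.
  by rewrite (lin0 (lmul_linearr _)) if_same.
have /= /andP[/eqP <- _] := h.
rewrite (linD (lmul_linearr _)) lmul_rmul -lmulM /arr pathM_l /psource /=.
rewrite -[x a]xl -lmulM videmM; case: eqP => [->|_] //.
by rewrite !(lin0 (lmul_linearl _)) (lin0 (rmul_linearl _)) addr0.
Qed.

Lemma wder_target (p : qpath Q) v :
  rmul (wder (parrows p)) (videm v) = if v == ptarget p then wder (parrows p) else 0.
Proof.
case: p => [[u s] h]; rewrite /ptarget /psource /parrows /=.
elim: s u h => [|a s IHs] u h /=; first by rewrite (lin0 (rmul_linearl _)) if_same.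
have /= /andP[/eqP ua wk] := h.
have /= := IHs _ wk; rewrite (linD (rmul_linearl _)) -lmul_rmul => ->.
have -> : rmul (x a) (word s) = rmul (x a) (pi (pbasis k (@QPath Q (target a, s) wk))).
  by rewrite path_word rmulM xr.
rewrite -rmulM pathM_r /ptarget /psource /=; case: eqP => _ //.
by rewrite (lin0 (rmul_linearr _)) (lin0 (lmul_linearr _)) addr0.
Qed.

Definition pder (y : B) : X :=
  \sum_(p <- msupp y) mcoeff p y *: wder (parrows p).

Lemma pder_linear : linear pder.
Proof. exact: (linext_linear (fun p => wder (parrows p))). Qed.

Lemma pder_path p : pder (pbasis k p) = wder (parrows p).
Proof.
by rewrite /pder msupp_pbasis big_seq_fset1 mcoeff_pbasis eqxx scale1r.
Qed.

Lemma pder_vertex v : pder (pv v) = 0.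
Proof. by rewrite pder_path. Qed.

Lemma pder_arrow a : pder (pa a) = x a.
Proof.
by rewrite pder_path /= /word big_nil rmul1 (lin0 (lmul_linearr _)) addr0.
Qed.

(** On composable paths this is [wder_cat].  On paths that do not compose, both
    terms vanish because [wder] of a path is fixed by the idempotents at its
    endpoints and killed by the others. *)
Lemma pderM y z : pder (y * z) = lmul (pi y) (pder z) + rmul (pder y) (pi z).
Proof.
elim/path_alg_ind: y => [|c y y' IHy IHy'|p].
- by rewrite mul0r !(lin0 pder_linear) linear0 (lin0 (lmul_linearl _))
    (lin0 (rmul_linearl _)) addr0.
- rewrite mulrDl -scalerAl !pder_linear IHy IHy' linearP lmul_linearl rmul_linearl.
  by rewrite scalerDr addrACA.
elim/path_alg_ind: z => [|c z z' IHz IHz'|q].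
- by rewrite mulr0 !(lin0 pder_linear) linear0 (lin0 (rmul_linearr _))
    (lin0 (lmul_linearr _)) addr0.
- rewrite mulrDr -scalerAr !pder_linear IHz IHz' linearP lmul_linearr rmul_linearr.
  by rewrite scalerDr addrACA.
rewrite path_mulE /pmul !pder_path; case: pcatP => [r e rs ra _|/eqP ne] /=.
  rewrite pder_path ra wder_cat !path_word rmulM lmulM wder_target e eqxx addrC.
  congr (_ + _); have := wder_source r (psource r); rewrite eqxx ra wder_cat.
  rewrite (linD (lmul_linearr _)) lmul_rmul wder_source rs eqxx.
  by move/addrI.
have -> : pi (pbasis k p) = pi (pbasis k p) * videm (ptarget p).
  by rewrite pathM_r eqxx.
have -> : pi (pbasis k q) = videm (psource q) * pi (pbasis k q).
  by rewrite pathM_l eqxx.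
rewrite (lin0 pder_linear) lmulM rmulM wder_source wder_target (negPf ne).
by rewrite eq_sym (negPf ne) (lin0 (lmul_linearr _)) (lin0 (rmul_linearl _)) addr0.
Qed.

End PathDerivation.

(** * The presentation relative to the vertices *)

Section Syzygy.
Variables (k : fieldType) (Q : quiver) (I : admissible_ideal k Q).
Local Notation L := (bound_quiver_algebra I).
Local Notation A := (env_alg L).
Local Notation B := (path_alg k Q).
Local Notation pi := (bqa_pi I : B -> L).
Local Notation pv v := (pbasis k (@vpath Q v)).
Local Notation pa a := (pbasis k (@apath Q a)).
Local Notation videm := (videm I).
Local Notation arr := (arr I).

Lemma pvM v w : pv v * pv w = if v == w then pv v else 0.
Proof. by rewrite path_mulE /pmul pcat_vl /psource /=; case: eqP => [->|]. Qed.

Lemma pv_pa a : pv (source a) * pa a = pa a.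
Proof. by rewrite path_mulE /pmul pcat_vl /psource eqxx. Qed.

Lemma pa_pv a : pa a * pv (target a) = pa a.
Proof. by rewrite path_mulE /pmul pcat_vr /ptarget /psource eqxx. Qed.

Lemma videm_arr a : videm (source a) * arr a = arr a.
Proof. by rewrite /arr pathM_l /psource eqxx. Qed.

Lemma arr_videm a : arr a * videm (target a) = arr a.
Proof. by rewrite /arr pathM_r /ptarget /psource eqxx. Qed.

Definition rho1 (a : arrow Q) : A := tens (videm (source a)) (videm (target a)).
Definition rho0 (v : vertex Q) : A := tens (videm v) (videm v).

Lemma rho1_idem a : rho1 a * rho1 a = rho1 a.
Proof. by rewrite [LHS]tensM !videmM !eqxx. Qed.
Lemma rho0_idem v : rho0 v * rho0 v = rho0 v.
Proof. by rewrite [LHS]tensM !videmM !eqxx. Qed.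

Definition T1 : lmodule A := idem_lmodule rho1.
Definition T0 : lmodule A := idem_lmodule rho0.
Definition gen1 a : T1 := igen rho1_idem a.
Definition gen0 v : T0 := igen rho0_idem v.

Lemma idem_tens_ind (J : finType) (rho : J -> A)
    (rho_idem : forall j, rho j * rho j = rho j) (S : idem_lmodule rho -> Prop) :
  submod_prop S -> (forall p q j, S (lmul p (rmul (igen rho_idem j) q))) ->
  forall t, S t.
Proof.
move=> [S0 SD] Sg t; rewrite [t](igen_sumE rho_idem).
have SA x y : S x -> S y -> S (x + y) by rewrite -{2}[x]scale1r; apply: SD.
elim/big_ind: _ => // j _; elim/env_ind: (icoef t j) => [|c M N hM hN|p q].
- by rewrite (lin0 (lact_linearl _)).
- by rewrite lact_linearl; apply: SD.
by rewrite lact_tens; apply: Sg.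
Qed.

Lemma T1_ind (S : T1 -> Prop) : submod_prop S ->
  (forall p q a, S (lmul p (rmul (gen1 a) q))) -> forall t, S t.
Proof. exact: idem_tens_ind. Qed.

Lemma T0_ind (S : T0 -> Prop) : submod_prop S ->
  (forall p q v, S (lmul p (rmul (gen0 v) q))) -> forall t, S t.
Proof. exact: idem_tens_ind. Qed.

Lemma gen1_rho a : lmul (videm (source a)) (rmul (gen1 a) (videm (target a))) = gen1 a.
Proof. by rewrite -lact_tens; apply: (lact_igen rho1_idem). Qed.

Lemma gen1_l a : lmul (videm (source a)) (gen1 a) = gen1 a.
Proof. by rewrite -{1}gen1_rho -lmulM videmM eqxx gen1_rho. Qed.

Lemma gen1_r a : rmul (gen1 a) (videm (target a)) = gen1 a.
Proof. by rewrite -{1}gen1_rho -lmul_rmul -rmulM videmM eqxx gen1_rho. Qed.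

Lemma gen0_rho v : lmul (videm v) (rmul (gen0 v) (videm v)) = gen0 v.
Proof. by rewrite -lact_tens; apply: (lact_igen rho0_idem). Qed.

Lemma gen0_l v w : lmul (videm v) (gen0 w) = if v == w then gen0 w else 0.
Proof.
rewrite -{1}gen0_rho -lmulM videmM; case: eqP => [->|_]; rewrite ?gen0_rho //.
exact: lin0 (lmul_linearl _).
Qed.

Lemma gen0_r v w : rmul (gen0 v) (videm w) = if v == w then gen0 v else 0.
Proof.
rewrite -{1}gen0_rho -lmul_rmul -rmulM videmM; case: eqP => [->|_]; rewrite ?gen0_rho //.
by rewrite (lin0 (rmul_linearr _)) (lin0 (lmul_linearr _)).
Qed.

(** The generator 1 ⊗ 1 of the tensor square of [L] over the vertices. *)
Definition eps : T0 := \sum_v gen0 v.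

Lemma videm_eps v : lmul (videm v) eps = gen0 v.
Proof.
rewrite /eps (lin_sum (lmul_linearr _)) (bigD1 v) //= gen0_l eqxx big1 ?addr0 //.
by move=> w /negPf nw; rewrite gen0_l eq_sym nw.
Qed.

Lemma eps_videm v : rmul eps (videm v) = gen0 v.
Proof.
rewrite /eps (lin_sum (rmul_linearl _)) (bigD1 v) //= gen0_r eqxx big1 ?addr0 //.
by move=> w /negPf nw; rewrite gen0_r nw.
Qed.

(** The universal derivation of kQ vanishing on the vertices, with the
    coefficients reduced to [L]. *)
Definition Delta : B -> T1 := @pder k Q I T1 gen1.

Lemma Delta_linear : linear Delta. Proof. exact: pder_linear. Qed.
Lemma Delta_vertex v : Delta (pv v) = 0. Proof. exact: pder_vertex. Qed.
Lemma Delta_arrow a : Delta (pa a) = gen1 a. Proof. exact: pder_arrow. Qed.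
Lemma DeltaM y z : Delta (y * z) = lmul (pi y) (Delta z) + rmul (Delta y) (pi z).
Proof. exact: (pderM gen1_l gen1_r). Qed.

(** The differential is prescribed so that it sends [Delta y] to the commutator
    of [y] with [eps]; see [dT_Delta]. *)
Lemma dT_exists : exists d : LHom T1 T0, forall a,
  d $ (gen1 a) = lmul (arr a) eps - rmul eps (arr a).
Proof.
have [d dE] := idem_lhom rho1 (fun a => lmul (arr a) eps - rmul eps (arr a)).
exists d => a; rewrite dE sum_igen [rho1 a]/(tens _ _) lact_tens.
rewrite (linB (rmul_linearl _)) (linB (lmul_linearr _)); congr (_ - _).
  by rewrite -lmul_rmul eps_videm -videm_eps -!lmulM videm_arr arr_videm.
by rewrite -rmulM arr_videm lmul_rmul videm_eps -eps_videm -rmulM videm_arr.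
Qed.

Definition dT : LHom T1 T0 := sval (cid dT_exists).

Lemma dT_gen a : dT $ (gen1 a) = lmul (arr a) eps - rmul eps (arr a).
Proof. exact: (svalP (cid dT_exists)). Qed.

Lemma dT_Delta y : dT $ (Delta y) = lmul (pi y) eps - rmul eps (pi y).
Proof.
elim/path_word_ind: y => [|v|a y IHy].
- split=> [|c y z IHy IHz].
    rewrite (lin0 Delta_linear) !linear0 (lin0 (lmul_linearl _)).
    by rewrite (lin0 (rmul_linearr _)) subr0.
  rewrite Delta_linear !linearP /= IHy IHz lmul_linearl rmul_linearr.
  by rewrite scalerBr opprD addrACA.
- by rewrite Delta_vertex linear0 [LHS]/= [X in lmul X]/(videm v) videm_eps eps_videm subrr.
rewrite DeltaM Delta_arrow linearD /= (LHom_lmul dT) (LHom_rmul dT) IHy dT_gen.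
rewrite (linB (lmul_linearr _)) (linB (rmul_linearl _)) rmorphM /=.
by rewrite lmulM rmulM lmul_rmul addrA subrK.
Qed.

Lemma eT_exists : exists e : LHom T0 (reg_bimod L), e $ eps = (1 : L).
Proof.
have [e eE] := idem_lhom rho0 (X := reg_bimod L) videm; exists e.
rewrite /eps linear_sum -[RHS]videm_sum; apply: eq_bigr => v _ /=.
by rewrite eE sum_igen [rho0 v]/(tens _ _) lact_tens reg_lmul reg_rmul !videmM eqxx
  videmM eqxx.
Qed.

Definition eT : LHom T0 (reg_bimod L) := sval (cid eT_exists).

Lemma eT_eps : eT $ eps = (1 : L).
Proof. exact: (svalP (cid eT_exists)). Qed.

Lemma eT_dT t : eT $ (dT $ t) = 0.
Proof.
elim/T1_ind: t => [|p q a].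
  split=> [|c s t s0 t0]; first by rewrite !linear0.
  by rewrite !linearP /= s0 t0 scaler0 addr0.
rewrite (LHom_lmul dT) (LHom_lmul eT) (LHom_rmul dT) (LHom_rmul eT) dT_gen.
rewrite linearB /= (LHom_lmul eT) (LHom_rmul eT) eT_eps.
rewrite [lmul (arr a) _]reg_lmul [rmul _ (arr a)]reg_rmul mulr1 [1 * _]mul1r subrr.
by rewrite (lin0 (rmul_linearl _)) (lin0 (lmul_linearr _)).
Qed.

(** The contraction of [T0] onto [rmul eps L]: moving the left factor of a tensor
    across [eps] costs a commutator, which is a value of [dT]. *)
Lemma T0_form t : exists y : T1, t = rmul eps (eT $ t) + dT $ y.
Proof.
elim/T0_ind: t => [|p q v].
  split=> [|c s t [y sE] [z tE]].
    by exists 0; rewrite !linear0 (lin0 (rmul_linearr _)) addr0.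
  exists (c *: y + z); rewrite {1}sE {1}tE !linearP /= rmul_linearr.
  by rewrite scalerDr addrACA.
exists (rmul (Delta (bqa_repr (p * videm v))) q).
rewrite (LHom_rmul dT) dT_Delta bqa_reprK lmul_rmul -videm_eps -lmulM.
rewrite (linB (rmul_linearl _)) (LHom_rmul eT) (LHom_lmul eT) eT_eps reg_rmul reg_lmul mulr1.
by rewrite rmulM addrCA subrr addr0.
Qed.

Lemma T_onto : limg (lfun_of eT) = fullv.
Proof.
apply/limg_fullP => y; exists (rmul eps y).
by rewrite (LHom_rmul eT) eT_eps reg_rmul mul1r.
Qed.

Lemma T_exact : limg (lfun_of dT) = lker (lfun_of eT).
Proof.
apply/vspaceP => t; rewrite memv_ker; apply/memv_imgP/eqP => [[y _ ->]|t0].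
  exact: eT_dT.
have [y] := T0_form t; rewrite t0 (lin0 (rmul_linearr _)) add0r => ->.
by exists y; first exact: memvf.
Qed.

Definition T_ppres : ppres (reg_bimod L) :=
  ProjPres (idem_projective rho1_idem) (idem_projective rho0_idem) T_onto T_exact.

(** Compatibility with the vertices on the right makes [sec] usable on tensors
    over the vertices. *)
Lemma section_exists : exists s : L -> B,
  [/\ linear s, forall x, pi (s x) = x & forall x v, s (x * videm v) = s x * pv v].
Proof.
pose s0 (x : L) : B := \sum_i coord (vbasis {:L}) i x *: bqa_repr (vbasis {:L})`_i.
have s0l : linear s0.
  move=> c x y; rewrite /s0 scaler_sumr -big_split; apply: eq_bigr => i _ /=.
  by rewrite linearP scalerDl scalerA.
have s0K x : pi (s0 x) = x.
  rewrite linear_sum [RHS]vbasis_coordE; apply: eq_bigr => i _.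
  by rewrite linearZ /= bqa_reprK.
pose s x := \sum_v s0 (x * videm v) * pv v; exists s; split=> [c x y|x|x v].
- rewrite /s scaler_sumr -big_split; apply: eq_bigr => v _ /=.
  by rewrite mulrDl -scalerAl s0l mulrDl scalerAl.
- rewrite linear_sum -[RHS]mulr1 -videm_sum mulr_sumr; apply: eq_bigr => v _.
  by rewrite [LHS]rmorphM /= s0K -mulrA -[bqa_pi I _]/(videm v) videmM eqxx.
rewrite /s mulr_suml; apply: eq_bigr => w _.
rewrite -!mulrA videmM pvM eq_sym; case: eqP => [->|_] //.
have -> : x * (0 : L) = 0 by exact: mulr0.
by rewrite (lin0 s0l) mul0r mulr0.
Qed.

Definition sec : L -> B := sval (cid section_exists).
Lemma sec_linear : linear sec.
Proof. by have [] := svalP (cid section_exists). Qed.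
Lemma secK x : pi (sec x) = x.
Proof. by have [] := svalP (cid section_exists). Qed.
Lemma sec_videm x v : sec (x * videm v) = sec x * pv v.
Proof. by have [] := svalP (cid section_exists). Qed.

End Syzygy.

(** * The syzygy is I/I^2 *)

Section SyzygyElements.
Variables (k : fieldType) (Q : quiver) (I : admissible_ideal k Q).
Local Notation L := (bound_quiver_algebra I).
Local Notation B := (path_alg k Q).
Local Notation pi := (bqa_pi I : B -> L).
Local Notation pv v := (pbasis k (@vpath Q v)).
Local Notation pa a := (pbasis k (@apath Q a)).
Local Notation videm := (videm I).
Local Notation arr := (arr I).
Local Notation sec := (@sec k Q I).
Local Notation Delta := (@Delta k Q I).
Local Notation T1 := (T1 I).
Local Notation T0 := (T0 I).
Local Notation gen1 := (gen1 I).
Local Notation gen0 := (gen0 I).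
Local Notation eps := (eps I).
Local Notation dT := (dT I).

Lemma idealP0 : I 0. Proof. by case: (adm_ideal I). Qed.
Lemma idealMl x y : I y -> I (x * y).
Proof. by case: (adm_ideal I) => _ _ /(_ x y) h /h[]. Qed.
Lemma idealMr x y : I x -> I (x * y).
Proof. by case: (adm_ideal I) => _ _ /(_ y x) h /h[]. Qed.
Lemma Delta_sec_videm p v : rmul (Delta (sec p)) (videm v) = Delta (sec (p * videm v)).
Proof. by rewrite sec_videm DeltaM Delta_vertex (lin0 (lmul_linearr _)) add0r. Qed.

Lemma icoef_tens (J : finType) (rho : J -> env_alg L)
    (rho_idem : forall j, rho j * rho j = rho j) p q j i :
  icoef (lmul p (rmul (igen rho_idem j) q)) i =
    if i == j then (tens p q : env_alg L) * rho j else 0.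
Proof.
by rewrite -lact_tens icoef_lact icoef_gen; case: eqP => _; rewrite ?mulr0.
Qed.

(** [R] is the contracting homotopy p ⊗ q |-> Delta(s(p)) q.  It is linear but not
    a bimodule map, since [sec] is not multiplicative. *)
Lemma retraction_exists : exists R : T0 -> T1, linear R /\
  forall p q, R (lmul p (rmul eps q)) = rmul (Delta (sec p)) q.
Proof.
pose h p q : T1 := rmul (Delta (sec p)) q.
have hl q : linear (h^~ q).
  by move=> c x y; rewrite /h sec_linear Delta_linear rmul_linearl.
have hr p : linear (h p) by exact: rmul_linearr.
pose R (t : T0) : T1 := \sum_v tens_lift h (icoef t v).
have Rl : linear R.
  move=> c x y; rewrite /R scaler_sumr -big_split; apply: eq_bigr => v _ /=.
  by rewrite icoef_linear tens_lift_linear.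
exists R; split=> // p q; rewrite /eps (lin_sum (rmul_linearl _)) (lin_sum (lmul_linearr _)).
rewrite (lin_sum Rl) -[q in RHS]mul1r -videm_sum mulr_suml (lin_sum (rmul_linearr _)).
apply: eq_bigr => v _; rewrite /R (bigD1 v) //= big1 => [|w /negPf nw].
  rewrite icoef_tens eqxx addr0 [(tens p q : env_alg L) * _]tensM tens_liftE //.
  by rewrite /h -Delta_sec_videm -rmulM mulrA videmM eqxx.
by rewrite icoef_tens nw (lin0 (tens_lift_linear _)).
Qed.

(** Every [t] is [R (dT t)] plus an element of [Delta I]: for the generator
    p ⊗ a ⊗ q that element is Delta ((s(p) a - s(p a)) q). *)
Lemma syzygy_form (t : T1) : dT $ t = 0 -> exists2 i, I i & t = Delta i.
Proof.
have [R [Rl RE]] := retraction_exists.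
suff [i Ii tE] : exists2 i, I i & t = R (dT $ t) + Delta i.
  by move=> t0; exists i => //; rewrite tE t0 (lin0 Rl) add0r.
elim/T1_ind: t => [|p q a].
  split=> [|c s t [i Ii sE] [j Ij tE]].
    exists 0; first exact: idealP0.
    by rewrite linear0 (lin0 Rl) (lin0 (@Delta_linear _ _ _)) addr0.
  exists (c *: i + j); first by case: (ideal_submod_prop (adm_ideal I)) => _; apply.
  by rewrite {1}sE {1}tE linearP Rl Delta_linear /= scalerDr addrACA.
pose i := sec p * pa a - sec (p * arr a).
have Ii : I i by apply/bqa_pi0; rewrite linearB /= rmorphM /= !secK subrr.
exists (i * bqa_repr q); first exact: idealMr.
rewrite (LHom_lmul dT) (LHom_rmul dT) dT_gen (linB (rmul_linearl _)).
rewrite (linB (lmul_linearr _)) (linB Rl) -lmul_rmul -lmulM RE -rmulM RE.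
rewrite DeltaM (proj2 (bqa_pi0 I _) Ii) (lin0 (lmul_linearl _)) add0r bqa_reprK.
rewrite /i (linB (@Delta_linear _ _ _)) (linB (rmul_linearl _)) DeltaM secK Delta_arrow.
rewrite (linD (rmul_linearl _)) lmul_rmul -rmulM.
have cancel (V : zmodType) (x u v : V) : x = u - v + (x + v - u).
  by rewrite addrC addrA subrK addrK.
by rewrite -lmul_rmul; apply: cancel.
Qed.

Lemma dT_ideal i : I i -> dT $ (Delta i) = 0.
Proof.
move=> /bqa_pi0 e; rewrite dT_Delta e.
by rewrite (lin0 (lmul_linearl _)) (lin0 (rmul_linearr _)) subrr.
Qed.

(** A bimodule map on [I] with values in [L], which necessarily kills I^2, factors
    through [Delta]; in particular an element of [I] with [Delta i = 0] is
    invisible to [f].  The factorization [phi] is p ⊗ a ⊗ q |->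
    f (s(p) a - s(p a)) q on all of [T1].  Evaluated on [Delta] of a path these
    terms telescope to f (s(1) x - s(x)). *)
Lemma syzygy_extension (f : B -> L) : linear f ->
  (forall y i, I i -> f (y * i) = pi y * f i) ->
  (forall i y, I i -> f (i * y) = f i * pi y) ->
  exists phi : T1 -> L, linear phi /\ forall i, I i -> phi (Delta i) = f i.
Proof.
move=> fl fL fR; pose g a p := f (sec p * pa a - sec (p * arr a)).
have gl a : linear (g a).
  move=> c x y; apply: etrans _ (fl _ _ _); congr (f _).
  by rewrite mulrDl -scalerAl !sec_linear mulrDl -scalerAl scalerBr opprD addrACA.
have hl a q : linear (fun p => g a p * q).
  by move=> c x y; rewrite gl mulrDl scalerAl.
have hr a p : linear (fun q => g a p * q).
  by move=> c x y; rewrite mulrDr scalerAr.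
pose phi (t : T1) : L := \sum_a tens_lift (fun p q => g a p * q) (icoef t a).
have phil : linear phi.
  move=> c x y; rewrite /phi scaler_sumr -big_split; apply: eq_bigr => v _ /=.
  by rewrite icoef_linear tens_lift_linear.
have Ig p a : I (sec p * pa a - sec (p * arr a)).
  by apply/bqa_pi0; rewrite linearB /= rmorphM /= !secK subrr.
have phi_gen p q a : phi (lmul p (rmul (gen1 a) q)) = g a p * q.
  rewrite /phi (bigD1 a) //= big1 => [|b /negPf nb]; last first.
    by rewrite icoef_tens nb (lin0 (tens_lift_linear _)).
  rewrite icoef_tens eqxx addr0 [(tens p q : env_alg L) * _]tensM tens_liftE //.
  rewrite mulrA -fR; last exact: Ig.
  rewrite /g -mulrA videm_arr sec_videm -mulrA pv_pa; congr (f _ * _).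
  by rewrite mulrBl -mulrA pa_pv -sec_videm -mulrA arr_videm.
have phi_Delta x p q : phi (lmul p (rmul (Delta x) q)) =
    f (sec p * x - sec (p * pi x)) * q.
  elim/path_word_ind: x p q => [|v p q|a y IHy p q].
  - split=> [p q|c x y IHx IHy p q].
      by rewrite (lin0 (@Delta_linear _ _ _)) (lin0 (rmul_linearl _))
        (lin0 (lmul_linearr _)) (lin0 phil) linear0 !mulr0 (lin0 (@sec_linear _ _ _))
        subrr (lin0 fl) mul0r.
    rewrite Delta_linear rmul_linearl lmul_linearr phil IHx IHy.
    rewrite scalerAl -mulrDl -fl; congr (f _ * _); rewrite linearP mulrDr mulrDr.
    by rewrite -!scalerAr sec_linear scalerBr opprD addrACA.
  - rewrite Delta_vertex (lin0 (rmul_linearl _)) (lin0 (lmul_linearr _)) (lin0 phil).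
    by rewrite [pi _]/(videm v) sec_videm subrr (lin0 fl) mul0r.
  rewrite DeltaM Delta_arrow (linD (rmul_linearl _)) (linD (lmul_linearr _)).
  rewrite (linD phil) -lmul_rmul -lmulM IHy -rmulM phi_gen mulrA -mulrDl.
  rewrite -fR; last exact: Ig.
  rewrite -(linD fl); congr (f _ * _).
  by rewrite rmorphM /= !mulrBl !mulrA addrC addrA subrK.
exists phi; split=> // i Ii.
have := phi_Delta i 1 1; rewrite lmul1 rmul1 mulr1 mul1r => ->.
by rewrite (proj2 (bqa_pi0 I _) Ii) (lin0 (@sec_linear _ _ _)) subr0 fL // secK mul1r.
Qed.

End SyzygyElements.

(** * The length filtration *)

Section LengthFiltration.
Variables (k : fieldType) (Q : quiver) (I : admissible_ideal k Q).
Local Notation L := (bound_quiver_algebra I).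
Local Notation B := (path_alg k Q).
Local Notation pi := (bqa_pi I : B -> L).
Local Notation pb p := (pbasis k (p : qpath Q)).
Local Notation Delta := (@Delta k Q I).
Local Notation T1 := (T1 I).
Local Notation gen1 := (gen1 I).
Local Notation eps := (eps I).
Local Notation dT := (dT I).

(** The span of the elements p ⊗ a ⊗ q with paths [p] and [q] of total length at
    least [n]. *)
Definition long n (t : T1) : Prop := forall S : T1 -> Prop, submod_prop S ->
  (forall (p q : qpath Q) a, (n <= size (parrows p) + size (parrows q))%N ->
     S (lmul (pi (pb p)) (rmul (gen1 a) (pi (pb q))))) -> S t.

Lemma long_submod n : submod_prop (long n).
Proof.
split=> [S [] //|c s t ns nt S hS Sg].
by case: (hS) => _; apply; [apply: ns | apply: nt].
Qed.

Lemma long_gen n (p q : qpath Q) a : (n <= size (parrows p) + size (parrows q))%N ->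
  long n (lmul (pi (pb p)) (rmul (gen1 a) (pi (pb q)))).
Proof. by move=> h S _; apply. Qed.

Lemma longW m n t : (m <= n)%N -> long n t -> long m t.
Proof.
move=> mn; apply; first exact: long_submod.
by move=> p q a h; apply: long_gen; apply: leq_trans h.
Qed.

Lemma long_linear n m (f : T1 -> T1) : linear f ->
  (forall (p q : qpath Q) a, (n <= size (parrows p) + size (parrows q))%N ->
     long m (f (lmul (pi (pb p)) (rmul (gen1 a) (pi (pb q)))))) ->
  forall t, long n t -> long m (f t).
Proof.
move=> fl fg t /(_ (fun t => long m (f t))); apply=> //; have [h0 hl] := long_submod m.
by split=> [|c u v hu hv]; rewrite ?(lin0 fl) // fl; apply: hl.
Qed.

Lemma pathM (p q : qpath Q) : exists2 r : option (qpath Q),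
  pi (pb p) * pi (pb q) = oapp (fun x => pi (pb x)) 0 r &
  forall x, r = Some x -> (size (parrows x) = size (parrows p) + size (parrows q))%N.
Proof.
exists (pcat p q).
  by rewrite -rmorphM path_mulE /pmul; case: pcat => //=; rewrite linear0.
by case: pcatP => // r _ _ er _ _ [<-]; rewrite er size_cat.
Qed.

Lemma long_path n t (r : qpath Q) : long n t ->
  long (n + size (parrows r)) (lmul (pi (pb r)) t) /\
  long (n + size (parrows r)) (rmul t (pi (pb r))).
Proof.
move=> nt; split.
  apply: (long_linear (lmul_linearr _)) nt => p q a h.
  rewrite -lmulM; have [[x|] -> /= xE] := pathM r p; last first.
    by rewrite (lin0 (lmul_linearl _)); case: (long_submod (n + size (parrows r))).
  by apply: long_gen; rewrite (xE x) // addnC -addnA leq_add2l.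
apply: (long_linear (rmul_linearl _)) nt => p q a h.
rewrite -lmul_rmul -rmulM; have [[x|] -> /= xE] := pathM q r; last first.
  rewrite (lin0 (rmul_linearr _)) (lin0 (lmul_linearr _)).
  by case: (long_submod (n + size (parrows r))).
by apply: long_gen; rewrite (xE x) // addnA leq_add2r.
Qed.

Lemma long_act n t (x : B) : long n t ->
  long n (lmul (pi x) t) /\ long n (rmul t (pi x)).
Proof.
move=> nt; have [h0 hl] := long_submod n.
elim/path_alg_ind: x => [|c y z [ly ry] [lz rz]|p].
- by rewrite linear0 (lin0 (lmul_linearl _)) (lin0 (rmul_linearr _)).
- by rewrite linearP lmul_linearl rmul_linearr; split; apply: hl.
have [h1 h2] := long_path p nt.
by split; [apply: longW h1 | apply: longW h2]; exact: leq_addr.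
Qed.

Lemma long0 t : long 0 t.
Proof.
elim/T1_ind: t => [|p q a]; first exact: long_submod.
rewrite -[p]bqa_reprK -[q]bqa_reprK lmul_rmul.
apply: (long_act _ (long_act _ _).1).2.
pose v := @vpath Q (source a); pose w := @vpath Q (target a).
by rewrite -gen1_rho; apply: (@long_gen 0 v w).
Qed.

Lemma long_arrow_ideal (y : B) : arrow_ideal y -> forall n t, long n t ->
  long n.+1 (lmul (pi y) t) /\ long n.+1 (rmul t (pi y)).
Proof.
pose J (x : B) := forall n t, long n t ->
  long n.+1 (lmul (pi x) t) /\ long n.+1 (rmul t (pi x)).
move=> /(_ J); apply; last first.
  by move=> _ [a ->] n t nt; have := long_path (apath a) nt; rewrite addn1.
split.
- move=> n t nt; rewrite linear0 (lin0 (lmul_linearl _)) (lin0 (rmul_linearr _)).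
  by have [] := long_submod n.+1.
- move=> x z Jx Jz n t nt; have [_ hl] := long_submod n.+1.
  have [h1 h2] := Jx n t nt; have [h3 h4] := Jz n t nt.
  rewrite linearD (linD (lmul_linearl _)) (linD (rmul_linearr _)).
  by split; rewrite -[X in long _ (X + _)]scale1r; apply: hl.
move=> b x Jx; split=> n t nt; rewrite rmorphM /= lmulM rmulM.
  split; first by apply: (long_act _ (Jx _ _ nt).1).1.
  by apply: (Jx _ _ (long_act _ nt).2).2.
split; first by apply: (Jx _ _ (long_act _ nt).1).1.
by apply: (long_act _ (Jx _ _ nt).2).2.
Qed.

(** If paths of length [n] lie in [I], then among [p] and [q] of total length
    at least [n + n] one vanishes in [L]. *)
Lemma long_eq0 : exists n, forall t, long n t -> t = 0.
Proof.
have [n [_ FI _]] := adm_bounds I.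
have pi0 (p : qpath Q) : (n <= size (parrows p))%N -> pi (pb p) = 0.
  by move=> h; apply/bqa_pi0/FI/arrow_pow_path.
exists (n + n)%N => t /(_ (fun t => t = 0)); apply.
  by split=> // c u v -> ->; rewrite scaler0 addr0.
move=> p q a h; have [np|] := leqP n (size (parrows p)).
  by rewrite pi0 // (lin0 (lmul_linearl _)).
move=> pn; have nq : (n <= size (parrows q))%N.
  by rewrite -(leq_add2l n) (leq_trans h) // leq_add2r ltnW.
by rewrite (pi0 q nq) (lin0 (rmul_linearr _)) (lin0 (lmul_linearr _)).
Qed.

(** [I] lies in the square of the arrow ideal, and Delta (y z) = y Delta z +
    Delta y z keeps one factor from the arrow ideal in each term. *)
Lemma long_Delta i : I i -> long 1 (Delta i).
Proof.
have [n [_ _ IF]] := adm_bounds I => /IF [s hs ->]; have [h0 hl] := long_submod 1.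
have arrow_id := ideal_gen_ideal
  (fun x : B => exists a : arrow Q, x = pbasis k (apath a)).
rewrite (lin_sum (@Delta_linear _ _ _)) big_seq; elim/big_ind: _ => //.
  by move=> u v; rewrite -{2}[u]scale1r; apply: hl.
move=> p /hs[F1 [s' hs' p2E]].
have F2 : arrow_ideal p.2.
  have [a0 aD aM] := arrow_id; rewrite p2E big_seq; elim/big_ind: _ => //.
  by move=> x /hs'[Fx _]; apply: (aM _ _ Fx).2.
rewrite DeltaM -[lmul _ _]scale1r; apply: hl.
  by apply: (long_arrow_ideal F1 (long0 _)).1.
by apply: (long_arrow_ideal F2 (long0 _)).2.
Qed.

Lemma long_syzygy t : dT $ t = 0 -> long 1 t.
Proof. by move=> /syzygy_form[i Ii ->]; apply: long_Delta. Qed.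

(** On the syzygy, going from [T] to [X] and back is the identity plus [w].  A map
    [g] composed with the round trip factors through [X], so it vanishes on the
    syzygy, where therefore [g = - g w].  The image of [w] lies in the syzygy,
    whose elements have positive length; so replacing [t] by [w t] increases the
    length until the element is zero. *)
Lemma T_kills_syzygy (X : ppres (reg_bimod L)) :
  (forall (f : LHom (pp1 X) (reg_bimod L)) x, ppd X $ x = 0 -> f $ x = 0) ->
  forall (g : LHom T1 (reg_bimod L)) t, dT $ t = 0 -> g $ t = 0.
Proof.
move=> Xk; have [a] := ppmap_exists (T_ppres I) X.
have [b] := ppmap_exists X (T_ppres I).
have [s [w [w0 abE]]] := ppmap_round_trip a b.
have {}w0 t : dT $ (w $ t) = 0 by exact: w0.
have {}abE t : pm1 b $ (pm1 a $ t) = t + s $ (dT $ t) + w $ t by exact: abE.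
have step (g : LHom T1 (reg_bimod L)) t : dT $ t = 0 -> g $ t = - g $ (w $ t).
  move=> t0; apply/eqP; rewrite -addr_eq0 -linearD; apply/eqP.
  have := abE t; rewrite t0 linear0 addr0 => <-.
  apply: etrans (esym (precomp_funE (pm1 b) g _)) _; apply: Xk.
  have e : ppd X $ (pm1 a $ t) = pm0 a $ (dT $ t) := pm_diff a t.
  by rewrite e t0 linear0.
have w_long n t : long n t -> long n.+1 (w $ t).
  have wl : linear (fun u : T1 => w $ u : T1) by move=> c u v; rewrite linearP.
  apply: (long_linear wl) => p q c h; rewrite (LHom_lmul w) (LHom_rmul w) lmul_rmul.
  have := (long_path q (long_path p (long_syzygy (w0 (gen1 c)))).1).2.
  by apply: longW; rewrite -addnA add1n ltnS.
have [N N0] := long_eq0.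
have main m n t (g : LHom T1 (reg_bimod L)) :
    (N <= n + m)%N -> long n t -> dT $ t = 0 -> g $ t = 0.
  elim: m n t g => [|m IHm] n t g h nt t0.
    by rewrite (N0 t) ?linear0 //; apply: longW nt; rewrite -[n]addn0.
  rewrite step // (IHm n.+1) ?oppr0 // ?addSnnS //.
  exact: w_long.
by move=> g t; apply: (main N 0%N) (long0 t).
Qed.

End LengthFiltration.

(** * From second cohomology to the conormal bimodule *)

Section SecondCohomology.
Variables (k : fieldType) (Q : quiver) (I : admissible_ideal k Q).
Local Notation L := (bound_quiver_algebra I).
Local Notation L2 := (bound_quiver_algebra (adm_square I)).
Local Notation B := (path_alg k Q).
Local Notation pi := (bqa_pi I : B -> L).
Local Notation pi2 := (bqa_pi (adm_square I) : B -> L2).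
Local Notation Delta := (@Delta k Q I).
Local Notation T1 := (T1 I).
Local Notation eps := (eps I).
Local Notation dT := (dT I).
Local Notation M := (reg_bimod L).
Local Notation conormal := (conormal I).

Lemma Delta_square y : ideal_mul I I y -> Delta y = 0.
Proof.
move=> [s hs ->]; rewrite (lin_sum (@Delta_linear _ _ _)) big_seq big1 // => p /hs[h1 h2].
rewrite DeltaM (proj2 (bqa_pi0 I _) h1) (proj2 (bqa_pi0 I _) h2).
by rewrite (lin0 (lmul_linearl _)) (lin0 (rmul_linearr _)) addr0.
Qed.

(** [Delta] kills I^2, so it descends to kQ/I^2. *)
Definition Delta2 (x : L2) : T1 := Delta (bqa_repr x).

Lemma Delta2_pi y : Delta2 (pi2 y) = Delta y.
Proof.
apply/eqP; rewrite -subr_eq0 -(linB (@Delta_linear _ _ _)); apply/eqP.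
by apply/Delta_square/(@bqa_pi_eq _ _ (adm_square I)); rewrite bqa_reprK.
Qed.

Lemma Delta2_linear : linear Delta2.
Proof.
move=> c x y; rewrite -[x]bqa_reprK -[y]bqa_reprK -linearP !Delta2_pi.
exact: Delta_linear.
Qed.

Lemma Delta2M x y : Delta2 (x * y) =
  lmul (square_proj x) (Delta2 y) + rmul (Delta2 x) (square_proj y).
Proof.
rewrite -[x]bqa_reprK -[y]bqa_reprK; set u := bqa_repr x; set v := bqa_repr y.
have <- : pi2 (u * v) = pi2 u * pi2 v by rewrite rmorphM.
by rewrite !Delta2_pi !square_proj_pi DeltaM.
Qed.

Lemma conormalP (x : L2) : x \in conormal <-> square_proj x = 0.
Proof.
split=> [/mem_conormal[i Ii ->]|x0].
  by rewrite square_proj_pi; apply/bqa_pi0.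
apply/mem_conormal; exists (bqa_repr x); last by rewrite bqa_reprK.
exact/bqa_pi0.
Qed.

Lemma bihom_exists (f : conormal_bimod I -> bqa_bimod I) : linear f ->
  (forall a x, f (conormal_lact a x) = bqa_pi I a * f x) ->
  (forall x a, f (conormal_ract x a) = f x * bqa_pi I a) ->
  exists g : BiHom (conormal_bimod I) (bqa_bimod I), forall x, bifun_of g x = f x.
Proof.
move=> fl fL fR; have [g gE] := lfun_exists fl.
exists (vsproj _ g) => x; rewrite /bifun_of vsprojK //.
apply/mem_bihoms; split=> [a y|y a].
  by rewrite gE fL gE.
by rewrite gE fR gE.
Qed.

Lemma square_proj_linear : linear (@square_proj k Q I).
Proof.
move=> c x y; rewrite -[x]bqa_reprK -[y]bqa_reprK -linearP !square_proj_pi.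
exact: linearP.
Qed.

Lemma square_projM (x y : L2) :
  square_proj (x * y) = (square_proj x * square_proj y : L).
Proof.
rewrite -[x]bqa_reprK -[y]bqa_reprK; set u := bqa_repr x; set v := bqa_repr y.
have <- : pi2 (u * v) = pi2 u * pi2 v by rewrite rmorphM.
by rewrite !square_proj_pi rmorphM.
Qed.

Variable P : proj_resolution M.
Local Notation d0 := (res_d P 0).
Local Notation d1 := (res_d P 1).
Local Notation Z2 := (subvs_of (cocycles P M 2)).

Lemma res_d01 v : d0 $ (d1 $ v) = 0.
Proof. by apply/eqP; rewrite -memv_ker -res_exact memv_img ?memvf. Qed.

Lemma res_d12 v : d1 $ (res_d P 2 $ v) = 0.
Proof. by apply/eqP; rewrite -memv_ker -res_exact memv_img ?memvf. Qed.

Lemma res_lift u : d0 $ u = 0 -> exists v, u = d1 $ v.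
Proof.
move=> u0; have : u \in limg (lfun_of d1) by rewrite res_exact memv_ker u0.
by move=> /memv_imgP[v _ ->]; exists v.
Qed.

(** A cocycle kills the kernel of [d1], so it induces a bimodule map on the image
    of [d1], which is the kernel of [d0]; outside that image [zbar] takes
    arbitrary values. *)
Definition zbar (z : Z2) (u : res_obj P 1) : M :=
  lfun_of (vsval z) ((lfun_of d1)^-1%VF u).

Lemma zbar_linear z : linear (zbar z).
Proof. by move=> c u v; rewrite /zbar !linearP. Qed.

Lemma zbar_linearl u : linear (zbar^~ u).
Proof. by move=> c y z; rewrite /zbar linearP lfun_of_lin. Qed.

Lemma zbarE z v : zbar z (d1 $ v) = vsval z $ v.
Proof.
apply/eqP; rewrite -subr_eq0 -linearB /=.
set u := _ - v; have : d1 $ u = 0.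
  rewrite linearB /= limg_lfunVK ?subrr //; exact: memv_img (memvf _).
move=> u0; have : u \in limg (lfun_of (res_d P 2)) by rewrite res_exact memv_ker u0.
by move=> /memv_imgP[t _ ->]; rewrite (proj1 (cocycleP (vsval z)) (subvsP z)).
Qed.

Lemma zbar_lmul z a u : d0 $ u = 0 -> zbar z (lmul a u) = (a * zbar z u : L).
Proof.
by move=> /res_lift[v ->]; rewrite -LHom_lmul !zbarE LHom_lmul reg_lmul.
Qed.

Lemma zbar_rmul z u b : d0 $ u = 0 -> zbar z (rmul u b) = (zbar z u * b : L).
Proof.
by move=> /res_lift[v ->]; rewrite -LHom_rmul !zbarE LHom_rmul reg_rmul.
Qed.

Variables (a : ppmap (T_ppres I) (res_ppres P)) (b : ppmap (res_ppres P) (T_ppres I)).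

Let a1 : LHom T1 (res_obj P 1) := pm1 a.
Let b1 : LHom (res_obj P 1) T1 := pm1 b.
Let a0 : LHom (T0 I) (res_obj P 0) := pm0 a.

Lemma a1_diff t : d0 $ (a1 $ t) = a0 $ (dT $ t).
Proof. exact: pm_diff a t. Qed.

Lemma a1_syzygy i : I i -> d0 $ (a1 $ (Delta i)) = 0.
Proof. by move=> Ii; rewrite a1_diff dT_ideal // linear0. Qed.

Lemma b1_boundary v : dT $ (b1 $ (d1 $ v)) = 0.
Proof.
by have e : _ = pm0 b $ (d0 $ _) := pm_diff b (d1 $ v); rewrite [LHS]e res_d01 linear0.
Qed.

Lemma conormal_repr (x : subvs_of conormal) : I (bqa_repr (vsval x)).
Proof.
by apply/bqa_pi0; apply: (proj1 (conormalP _) (subvsP x)).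
Qed.

Lemma restriction_exists (z : Z2) :
  exists f : BiHom (conormal_bimod I) (bqa_bimod I),
    forall x : subvs_of conormal, bifun_of f x = zbar z (a1 $ (Delta2 (vsval x))).
Proof.
apply: bihom_exists => [c x y|y x|x y].
- by rewrite linearP Delta2_linear linearP zbar_linear.
- rewrite conormal_lactE Delta2M square_proj_pi (proj1 (conormalP _) (subvsP x)).
  rewrite (lin0 (rmul_linearr _)) addr0 LHom_lmul zbar_lmul //.
  exact/a1_syzygy/conormal_repr.
rewrite conormal_ractE Delta2M square_proj_pi (proj1 (conormalP _) (subvsP x)).
rewrite (lin0 (lmul_linearl _)) add0r LHom_rmul zbar_rmul //.
exact/a1_syzygy/conormal_repr.
Qed.

Definition restriction z := sval (cid (restriction_exists z)).

Lemma restrictionE z (x : subvs_of conormal) :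
  bifun_of (restriction z) x = zbar z (a1 $ (Delta2 (vsval x))).
Proof. exact: (svalP (cid (restriction_exists z))). Qed.

Lemma restriction_linear : linear restriction.
Proof.
move=> c y z; apply: val_inj; apply/lfunP => x.
rewrite (linearP vsval) add_lfunE scale_lfunE.
by rewrite -!/(bifun_of _) !restrictionE zbar_linearl.
Qed.

(** On bar cochains, [z] is evaluated at the coboundary of [bc1 h], and the
    restriction of [z] at the coboundary of [a1 (Delta2 (S x))].  The difference
    [n] of these two cochains with values in [P1] becomes, after subtracting the
    inner derivation [ad], a cochain [m] with values in ker [d0].  Inner
    derivations have no coboundary, so composing [m] with [zbar z] gives the
    required 1-cochain. *)
Lemma restriction_canonical z : canonical_class z (restriction z).
Proof.
move=> h S SK.
have u0 : res_aug P $ (bc0 h - a0 $ eps) = 0.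
  have e : res_aug P $ (a0 $ eps) = eT I $ eps := pm_aug a eps.
  by rewrite linearB /= e eT_eps bc0_aug subrr.
have [w wE] : exists w, d0 $ w = bc0 h - a0 $ eps.
  have : bc0 h - a0 $ eps \in limg (lfun_of d0) by rewrite res_exact0 memv_ker u0.
  by move=> /memv_imgP[w _ ->]; exists w.
pose ad x := lmul x w - rmul w x.
pose n x := bc1 h x - a1 $ (Delta2 (S x)).
pose m x := n x - ad x.
have d0n x : d0 $ (n x) = lmul x (d0 $ w) - rmul (d0 $ w) x.
  rewrite linearB /= bc1_diff a1_diff dT_Delta -[bqa_pi I _]/(square_proj (S x)) SK.
  rewrite linearB /= LHom_lmul LHom_rmul wE (linB (lmul_linearr _)) (linB (rmul_linearl _)).
  by rewrite lmul.unlock rmul.unlock !opprD addrACA.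
have d0m x : d0 $ (m x) = 0.
  by rewrite linearB /= d0n linearB /= LHom_lmul LHom_rmul subrr.
have rearr (V : zmodType) (p q r p' q' r' : V) :
    p - q + r - (p' + r' - q') = (p - p') - (q - q') + (r - r').
  by rewrite !opprB opprD !addrA [LHS](ACl (1*5*4*2*3*6)).
have sub_linear (V W : lmodType k) (f g : V -> W) :
    linear f -> linear g -> linear (fun x => f x - g x).
  by move=> fl gl c x y; rewrite fl gl scalerBr opprD addrACA.
have gl : linear (fun x => zbar z (m x)).
  have adl : linear ad.
    by apply: sub_linear; [exact: lmul_linearl | exact: rmul_linearr].
  have nl : linear n.
    apply: sub_linear; first exact: bc1_linear.
    by move=> c x y; rewrite linearP Delta2_linear linearP.
  have ml : linear m by apply: sub_linear.
  by move=> c x y; rewrite ml zbar_linear.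
have [g gE] := lfun_exists gl; exists g => x y.
rewrite restrictionE vsprojK; last first.
  apply/conormalP; rewrite (linB square_proj_linear) square_projM !SK.
  exact: subrr.
rewrite (linB Delta2_linear) Delta2M !SK linearB linearD /= !LHom_lmul !LHom_rmul.
rewrite -zbarE bc2_diff -(linB (@zbar_linear z)) !gE.
rewrite -zbar_lmul // -zbar_rmul // -(linB (@zbar_linear z)) -(linD (@zbar_linear z)).
congr (zbar z _).
have -> : lact (tens x 1) (bc1 h y) = lmul x (bc1 h y) by rewrite lmul.unlock.
have -> : lact (tens 1 y) (bc1 h x) = rmul (bc1 h x) y by rewrite rmul.unlock.
have ad0 : lmul x (ad y) + rmul (ad x) y - ad (x * y) = 0.
  rewrite /ad (linB (lmul_linearr _)) (linB (rmul_linearl _)) lmulM rmulM lmul_rmul.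
  by rewrite opprB !addrA !subrK subrr.
rewrite rearr -(linB (lmul_linearr _)) -(linB (rmul_linearl _)).
rewrite [in RHS](linB (lmul_linearr _)) [in RHS](linB (rmul_linearl _)) -rearr ad0.
by rewrite subr0.
Qed.

End SecondCohomology.

(** * Bijectivity *)

Section Bijectivity.
Variables (k : fieldType) (Q : quiver) (I : admissible_ideal k Q).
Local Notation L := (bound_quiver_algebra I).
Local Notation L2 := (bound_quiver_algebra (adm_square I)).
Local Notation B := (path_alg k Q).
Local Notation pi := (bqa_pi I : B -> L).
Local Notation pi2 := (bqa_pi (adm_square I) : B -> L2).
Local Notation Delta := (@Delta k Q I).
Local Notation T1 := (T1 I).
Local Notation dT := (dT I).
Local Notation M := (reg_bimod L).
Local Notation conormal := (conormal I).

Variable P : proj_resolution M.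
Local Notation d0 := (res_d P 0).
Local Notation d1 := (res_d P 1).
Local Notation Z2 := (subvs_of (cocycles P M 2)).
Variables (a : ppmap (T_ppres I) (res_ppres P)) (b : ppmap (res_ppres P) (T_ppres I)).
Let a1 : LHom T1 (res_obj P 1) := pm1 a.
Let b1 : LHom (res_obj P 1) T1 := pm1 b.

Definition conormal_class (y : B) : subvs_of conormal := vsproj conormal (pi2 y).

Lemma conormal_classE y : I y -> vsval (conormal_class y) = pi2 y.
Proof.
by move=> /bqa_pi0 y0; rewrite vsprojK //; apply/conormalP; rewrite square_proj_pi.
Qed.

Lemma restriction_class z i : I i ->
  bifun_of (restriction a z) (conormal_class i) = zbar z (a1 $ (Delta i)).
Proof. by move=> Ii; rewrite restrictionE conormal_classE // Delta2_pi. Qed.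

(** On the image of [d1] the round trip P -> T -> P is [1 + w], where [w] lifts to
    [s1 : P1 -> P2].  If the restriction of [z] to the syzygy of [T] is zero, this
    leaves [z = - z s1 d1]. *)
Lemma restriction_eq0 z : restriction a z = 0 -> Ext_class z = 0.
Proof.
move=> r0; have [s [w [w0 abE]]] := ppmap_round_trip b a.
have wim x : w $ x \in limg (lfun_of d1) by rewrite res_exact memv_ker [_ $ (w $ x)]w0.
have [s1 s1E] := proj_lift (@res_proj _ _ _ P 1) wim.
have {}s1E x : d1 $ (s1 $ x) = w $ x := s1E x.
have {}abE x : a1 $ (b1 $ x) = x + s $ (d0 $ x) + w $ x := abE x.
apply/Ext_class0; exists (- precomp_fun s1 (vsval z)); apply: LHom_eq => v.
have [i Ii bE] := syzygy_form (b1_boundary b v).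
rewrite precompE -[- _]sub0r lfun_ofB lfun_of0 sub0r precomp_funE.
have := restriction_class z Ii; rewrite r0 -bE.
rewrite abE res_d01 linear0 addr0 -s1E (linD (@zbar_linear _ _ _ _ z)) !zbarE.
rewrite /bifun_of linear0 zero_lfunE => /esym/eqP.
by rewrite addr_eq0 => /eqP.
Qed.

Hypothesis T_kills : forall (g : LHom T1 M) t, dT $ t = 0 -> g $ t = 0.

(** The restriction of a coboundary extends to [T1], so it vanishes by
    [T_kills]. *)
Lemma restriction_coboundary z : Ext_class z = 0 -> restriction a z = 0.
Proof.
move=> /Ext_class0[y zE]; apply: val_inj; apply/lfunP => x.
rewrite (linear0 vsval) zero_lfunE -[LHS]/(bifun_of _ x) restrictionE.
set t := Delta2 _; have t0 : dT $ t = 0 by exact/dT_ideal/conormal_repr.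
have [v vE] : exists v, a1 $ t = d1 $ v.
  by apply: res_lift; rewrite a1_diff t0 linear0.
rewrite [pm1 a $ t]vE zbarE zE precompE -vE.
exact: etrans (esym (precomp_funE _ _ _)) (T_kills (precomp_fun a1 y) t0).
Qed.

Lemma conormal_class_linear : linear conormal_class.
Proof. by move=> c x y; rewrite /conormal_class !linearP. Qed.

Lemma conormal_class_lmul y i : I i ->
  conormal_class (y * i) = conormal_lact y (conormal_class i).
Proof.
move=> Ii; apply: val_inj; rewrite [RHS]conormal_lactE [LHS]conormal_classE.
  by rewrite conormal_classE // rmorphM.
exact: idealMl.
Qed.

Lemma conormal_class_rmul i y : I i ->
  conormal_class (i * y) = conormal_ract (conormal_class i) y.
Proof.
move=> Ii; apply: val_inj; rewrite [RHS]conormal_ractE [LHS]conormal_classE.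
  by rewrite conormal_classE // rmorphM.
exact: idealMr.
Qed.

(** The cocycle is the extension [phi] of [f] composed with [P2 -> P1 -> T1].
    Restricting it back to [T] gives [f] up to the term [phi w], which is a
    bimodule map on all of [T1] and so vanishes on the syzygy. *)
Lemma restriction_onto (f : BiHom (conormal_bimod I) (bqa_bimod I)) :
  exists z, restriction a z = f.
Proof.
have [fL fR] := proj1 (mem_bihoms _) (subvsP f).
pose fh (y : B) : L := bifun_of f (conormal_class y).
have fhl : linear fh by move=> c x y; rewrite /fh conormal_class_linear linearP.
have [phi [phil phiE]] : exists phi : T1 -> L,
    linear phi /\ forall i, I i -> phi (Delta i) = fh i.
  apply: syzygy_extension => // [y i Ii|i y Ii].
    by rewrite /fh conormal_class_lmul //; apply: fL.
  by rewrite /fh conormal_class_rmul //; apply: fR.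
have phiL x t : dT $ t = 0 -> phi (lmul x t) = x * phi t.
  move=> /syzygy_form[i Ii ->]; rewrite phiE // -{1}[x]bqa_reprK.
  have -> : lmul (pi (bqa_repr x)) (Delta i) = Delta (bqa_repr x * i).
    by rewrite DeltaM (proj2 (bqa_pi0 I _) Ii) (lin0 (rmul_linearr _)) addr0.
  rewrite phiE; last exact: idealMl.
  by rewrite /fh conormal_class_lmul // -{2}[x]bqa_reprK; apply: fL.
have phiR t x : dT $ t = 0 -> phi (rmul t x) = phi t * x.
  move=> /syzygy_form[i Ii ->]; rewrite phiE // -{1}[x]bqa_reprK.
  have -> : rmul (Delta i) (pi (bqa_repr x)) = Delta (i * bqa_repr x).
    by rewrite DeltaM (proj2 (bqa_pi0 I _) Ii) (lin0 (lmul_linearl _)) add0r.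
  rewrite phiE; last exact: idealMr.
  by rewrite /fh conormal_class_rmul // -{2}[x]bqa_reprK; apply: fR.
have [y yE] : exists y : LHom (res_obj P 2) M, forall v, y $ v = phi (b1 $ (d1 $ v)).
  apply: bilhom_exists => [c u v|x v|v x].
  - by rewrite !linearP phil.
  - by rewrite !LHom_lmul phiL ?reg_lmul //; apply: b1_boundary.
  by rewrite !LHom_rmul phiR ?reg_rmul //; apply: b1_boundary.
have yZ : y \in cocycles P M 2.
  by apply/cocycleP => v; rewrite yE res_d12 !linear0 (lin0 phil).
exists (vsproj _ y); apply: val_inj; apply/lfunP => x.
rewrite -[LHS]/(bifun_of _ x) restrictionE.
have [i Ii xE] := proj1 (mem_conormal _) (subvsP x).
rewrite xE Delta2_pi.
have [v vE] : exists v, a1 $ (Delta i) = d1 $ v by apply: res_lift; apply: a1_syzygy.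
rewrite [pm1 a $ _]vE zbarE vsprojK // yE -vE.
have [s [w [w0 abE]]] := ppmap_round_trip a b.
have {}w0 t : dT $ (w $ t) = 0 := w0 t.
have {}abE t : b1 $ (a1 $ t) = t + s $ (dT $ t) + w $ t := abE t.
have [g gE] : exists g : LHom T1 M, forall t, g $ t = phi (w $ t).
  apply: bilhom_exists => [c t u|q t|t q].
  - by rewrite linearP phil.
  - by rewrite LHom_lmul phiL // reg_lmul.
  by rewrite LHom_rmul phiR // reg_rmul.
rewrite abE dT_ideal // linear0 addr0 (linD phil) -gE T_kills ?dT_ideal // addr0 phiE //.
rewrite /fh; congr (bifun_of f _); apply: val_inj.
by rewrite [LHS]conormal_classE // xE.
Qed.

End Bijectivity.

Theorem corollary4p8 (k : fieldType) (Q : quiver) (I : admissible_ideal k Q)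
    (pres : min_proj_pres (reg_bimod (bound_quiver_algebra I)))
    (P : proj_resolution (reg_bimod (bound_quiver_algebra I))) :
  excess pres P = 0 ->
  exists Phi : {linear HH P 2 -> BiHom (conormal_bimod I) (bqa_bimod I)},
    bijective Phi /\
    forall z : subvs_of (cocycles P (reg_bimod (bound_quiver_algebra I)) 2),
      canonical_class z (Phi (Ext_class z)).
Proof.
move=> ex0.
have kills := T_kills_syzygy (X := min_ppres pres) (excess0_kills_syzygy ex0).
have [a] := ppmap_exists (T_ppres I) (res_ppres P).
have [b] := ppmap_exists (res_ppres P) (T_ppres I).
pose F (x : HH P 2) := restriction a (vquot_repr x).
have FE z : F (Ext_class z) = restriction a z.
  apply/eqP; rewrite -subr_eq0 -(linB (@restriction_linear _ _ _ _ a)); apply/eqP.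
  apply: restriction_coboundary => //; rewrite (linB (@Ext_class_linear _ _ _ _ _ _)).
  by rewrite [Ext_class (vquot_repr _)]vquot_reprK subrr.
have Ext_onto (x : HH P 2) : exists z, x = Ext_class z.
  by exists (vquot_repr x); rewrite [RHS]vquot_reprK.
have Fl : linear F.
  move=> c x y; have [u ->] := Ext_onto x; have [v ->] := Ext_onto y.
  by rewrite -Ext_class_linear !FE restriction_linear.
pose m := GRing.isLinear.Build _ _ _ _ F Fl.
pose Phi : {linear HH P 2 -> BiHom (conormal_bimod I) (bqa_bimod I)} := HB.pack F m.
exists Phi; split; last by move=> z; rewrite /= FE; apply: restriction_canonical.
have Finj x y : F x = F y -> x = y.
  move=> e; apply/eqP; rewrite -subr_eq0; apply/eqP.
  have [u uE] := Ext_onto (x - y); rewrite uE; apply: (@restriction_eq0 _ _ _ _ a b).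
  by rewrite -FE -uE (linB Fl) e subrr.
have Fonto f : exists x, F x = f.
  by have [z zE] := restriction_onto a b kills f; exists (Ext_class z); rewrite FE.
exists (fun f => sval (cid (Fonto f))) => [x|f]; last exact: (svalP (cid (Fonto f))).
exact/Finj/(svalP (cid (Fonto (F x)))).
Qed.
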